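(* Let $m\ge 2$ and $1\le k\le m-1$. The transition probabilities of the pair $(X^{k+1},X^{k})$ from the Aztec diamond particle process $(X^1(t),\dots,X^m(t))_{t=0,1,2,\dots}$ are $$\mathfrak{q}_t^{k,+}((x,y),(x',y')):=\frac{h_k(y')}{h_k(y)}\,\mathfrak{q}_t^{k}((x,y),(x',y')),$$ that is, for $s,t\in\{0,1,2,\dots\}$ and $(x,y),(x',y')\in\mathcal W^{k+1,k}$, $$\mathbb P\big[(X^{k+1}(s+t),X^k(s+t))=(x',y')\,\big|\,(X^{k+1}(s),X^k(s))=(x,y)\big]=\mathfrak{q}_t^{k,+}((x,y),(x',y')).$$ (Here $\mathfrak{q}$ is just a letter, denoting the kernels defined in the context.)
   Context: Aztec diamond particle process on $m$ lines: $(X^1(t),\dots,X^m(t))_{t=0,1,2,\dots}$ with $X^k(t)=(X^k_1(t),\dots,X^k_k(t))\in\mathbb Z^k$. Let $\beta^j_i(t)$ ($1\le i\le j\le m$, $t\ge1$) be i.i.d. with $\mathbb P[\beta^j_i(t)=0]=\mathbb P[\beta^j_i(t)=1]=\frac12$. Initial condition: $X^j_i(0)=i$ for $1\le i\le j\le m$. For $t=1,2,\dots$: - $X^1_1(t)=X^1_1(t-1)+\beta^1_1(t)$; - for $j\ge2$: $X^j_1(t)=X^j_1(t-1)+\beta^j_1(t)-\mathbf 1\{X^j_1(t-1)+\beta^j_1(t)=X^{j-1}_1(t)+1\}$; - for $j\ge2$: $X^j_j(t)=X^j_j(t-1)+\beta^j_j(t)+\mathbf 1\{X^j_j(t-1)+\beta^j_j(t)=X^{j-1}_{j-1}(t)\}$;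 - for $j\ge3$, $1<i<j$: $X^j_i(t)=X^j_i(t-1)+\beta^j_i(t)-\mathbf 1\{X^j_i(t-1)+\beta^j_i(t)=X^{j-1}_i(t)+1\}+\mathbf 1\{X^j_i(t-1)+\beta^j_i(t)=X^{j-1}_{i-1}(t)\}$. $\mathcal W^{n+1,n}=\{(x,y)\in\mathbb Z^{n+1}\times\mathbb Z^n: x_1\le y_1<x_2\le y_2<\dots\le y_n<x_{n+1}\}$; $h_n(y)=\prod_{1\le i<j\le n}(y_j-y_i)$. Let $\phi=\frac12(\delta_0+\delta_1):\mathbb Z\to\mathbb R$, where $\delta_i(x)=1$ if $x=i$ and $0$ otherwise; $\phi^{(0)}=\delta_0$, $\phi^{(t)}=\phi^{(t-1)}*\phi$ (convolution on $\mathbb Z$); $\Delta\psi(x)=\psi(x)-\psi(x-1)$; $\Delta^{-1}\psi(x)=\sum_{y=-\infty}^x\psi(y)$. For $t=0,1,2,\dots$ and $(x,y),(x',y')\in\mathcal W^{n+1,n}$, $$\mathfrak{q}_t^n((x,y),(x',y'))=\det\begin{bmatrix}A&B\\ C&D\end{bmatrix},$$ where $A$ is $(n+1)\times(n+1)$ with entries $A_{ij}=\phi^{(t)}(x'_j-x_i)$; $B$ is $(n+1)\times n$ with $B_{ij}=\Delta^{-1}\phi^{(t)}(y'_j-x_i)-\mathbf 1\{j\ge i\}$; $C$ is $n\times(n+1)$ with $C_{ij}=\Delta\phi^{(t)}(x'_j-y_i)$; $D$ is $n\times n$ with $D_{ij}=\phi^{(t)}(y'_j-y_i)$. The conditional probability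 is understood for $(x,y)$ such that the conditioning event has positive probability. *)

(* Defs.v *)
From HB Require Import structures.
From mathcomp Require Import all_boot all_order all_algebra finmap.
From mathcomp Require Import all_classical all_reals all_analysis.

Set Implicit Arguments.
Unset Strict Implicit.
Unset Printing Implicit Defensive.

Import Order.TTheory GRing.Theory Num.Theory.
Import numFieldNormedType.Exports.

Local Open Scope classical_set_scope.
Local Open Scope ring_scope.

(** Probability *)

Definition mutually_independent d d' (T : measurableType d)
    (T' : measurableType d') (R : realType) (P : probability T R)
    (I : choiceType) (D : set I) (Y : I -> {RV P >-> T'}) : Prop :=
  forall (J : {fset I}) (B : I -> set T'),
    [set` J] `<=` D -> (forall i, measurable (B i)) ->
    P (\bigcap_(i in [set` J]) Y i @^-1` B i)
      = (\prod_(i <- J) P (Y i @^-1` B i))%E.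

(* The conditional probability of A given B, meaningful when 0 < P B. *)
Definition cond_prob d (T : measurableType d) (R : realType)
    (P : probability T R) (A B : set T) : R :=
  fine (P (A `&` B)) / fine (P B).

(** The Aztec diamond particle process.  [X j i t] and [b j i t] stand for
    $X^j_i(t)$ and $\beta^j_i(t)$; particles i = 1, ..., j and lines
    j = 1, ..., m are numbered from 1, and values at other indices are
    irrelevant. *)

Definition fair_coins d (T : measurableType d) (R : realType)
    (P : probability T R) (m : nat)
    (beta : nat -> nat -> nat -> {RV P >-> nat}) : Prop :=
  [/\ forall j i t, (1 <= i <= j)%N -> (j <= m)%N -> (1 <= t)%N ->
        P (beta j i t @^-1` [set 0%N]) = (2^-1)%:E,
      forall j i t, (1 <= i <= j)%N -> (j <= m)%N -> (1 <= t)%N ->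
        P (beta j i t @^-1` [set 1%N]) = (2^-1)%:E
    & mutually_independent
        [set p : nat * nat * nat |
          [&& 1 <= p.1.2 <= p.1.1, p.1.1 <= m & 1 <= p.2]%N]
        (fun p => beta p.1.1 p.1.2 p.2)].

Definition aztec_dynamics (m : nat) (b : nat -> nat -> nat -> nat)
    (X : nat -> nat -> nat -> int) : Prop :=
  [/\ forall j i, (1 <= i <= j)%N -> (j <= m)%N -> X j i 0%N = i%:Z,
      forall t, X 1%N 1%N t.+1 = X 1%N 1%N t + (b 1%N 1%N t.+1)%:Z,
      forall j t, (2 <= j <= m)%N ->
        let z := X j 1%N t + (b j 1%N t.+1)%:Z in
        X j 1%N t.+1 = z - (z == X j.-1 1%N t.+1 + 1)%:R,
      forall j t, (2 <= j <= m)%N ->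
        let z := X j j t + (b j j t.+1)%:Z in
        X j j t.+1 = z + (z == X j.-1 j.-1 t.+1)%:R
    & forall j i t, (3 <= j <= m)%N -> (1 < i < j)%N ->
        let z := X j i t + (b j i t.+1)%:Z in
        X j i t.+1 = z - (z == X j.-1 i t.+1 + 1)%:R
                       + (z == X j.-1 i.-1 t.+1)%:R].

(* The vector $X^k(t)$; the entry at ordinal i is particle number i + 1. *)
Definition line_state (T : Type) (X : nat -> nat -> nat -> T -> int)
    (k t : nat) (w : T) : 'rV[int]_k :=
  \row_(i < k) X k i.+1 t w.

Definition pair_event (T : Type) (X : nat -> nat -> nat -> T -> int)
    (k t : nat) (x : 'rV[int]_k.+1) (y : 'rV[int]_k) : set T :=
  [set w | (line_state X k.+1 t w, line_state X k t w) = (x, y)].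

(** The interlacing cone and the kernels *)

(* [lift ord_max i] and [lift ord0 i] are the elements i and i + 1 of
   'I_n.+1. *)
Definition interlaced (n : nat) (x : 'rV[int]_n.+1) (y : 'rV[int]_n) : Prop :=
  forall i : 'I_n,
    x ord0 (lift ord_max i) <= y ord0 i < x ord0 (lift ord0 i).

Definition vandermonde (R : realType) (n : nat) (y : 'rV[int]_n) : R :=
  \prod_(i < n) \prod_(j < n | (i < j)%N) (y ord0 j - y ord0 i)%:~R.

Definition delta (R : realType) (a z : int) : R := (z == a)%:R.

(* In [convolution] and [Delta_inv] the sums over infinite subsets of int are
   [fsbigop] sums: they are the usual sums for finitely supported summands,
   which is the case for all the functions [phi_iter t] below. *)
Definition convolution (R : realType) (f g : int -> R) (z : int) : R :=
  \sum_(u \in [set: int]) f u * g (z - u).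

Definition phi (R : realType) (z : int) : R :=
  2^-1 * (delta R 0 z + delta R 1 z).

Fixpoint phi_iter (R : realType) (t : nat) : int -> R :=
  if t is t'.+1 then convolution (phi_iter R t') (@phi R) else delta R 0.

Definition Delta (R : realType) (f : int -> R) (z : int) : R :=
  f z - f (z - 1).

Definition Delta_inv (R : realType) (f : int -> R) (z : int) : R :=
  \sum_(u \in [set u : int | u <= z]) f u.

(* The indicator in the upper right block compares two indices both shifted
   by one with respect to the numbering from 1. *)
Definition q_kernel (R : realType) (n t : nat)
    (x : 'rV[int]_n.+1) (y : 'rV[int]_n)
    (x' : 'rV[int]_n.+1) (y' : 'rV[int]_n) : R :=
  \det (block_mx
    (\matrix_(i < n.+1, j < n.+1)
        phi_iter R t (x' ord0 j - x ord0 i))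
    (\matrix_(i < n.+1, j < n)
        (Delta_inv (phi_iter R t) (y' ord0 j - x ord0 i) - (i <= j)%N%:R))
    (\matrix_(i < n, j < n.+1)
        Delta (phi_iter R t) (x' ord0 j - y ord0 i))
    (\matrix_(i < n, j < n)
        phi_iter R t (y' ord0 j - y ord0 i))).

Definition q_plus_kernel (R : realType) (n t : nat)
    (x : 'rV[int]_n.+1) (y : 'rV[int]_n)
    (x' : 'rV[int]_n.+1) (y' : 'rV[int]_n) : R :=
  vandermonde R y' / vandermonde R y * q_kernel R t x y x' y'.

(* Main.v *)
Require Import Defs.
From HB Require Import structures.
From mathcomp Require Import all_boot all_order all_algebra perm finmap.
From mathcomp Require Import all_classical all_reals all_analysis.
From mathcomp Require Import zify ring.

Set Implicit Arguments.
Unset Strict Implicit.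
Unset Printing Implicit Defensive.

Import Order.TTheory GRing.Theory Num.Theory.

Local Open Scope classical_set_scope.
Local Open Scope ring_scope.

(** If the rows of a Gelfand-Tsetlin pattern evolve by the particle dynamics,
    the uniform measure on the patterns with top row [x] is carried by one step
    to an average of the uniform measures on the patterns whose top row is
    reached from [x] by independent Bernoulli jumps that do not collide.  This
    reduces to two consecutive lines, where it is a count: when an upper particle
    touches the lower particle [y'_j], one of the two possible previous positions
    of [y'_j] is lost, and the factor 2 is recovered from the upper particle,
    whose two coins then have the same outcome.

    Hence, starting from the packed configuration, the lines below line [k] are
    uniform given lines [k] and [k + 1], and the pair evolves by one-step
    killed-and-reflected Bernoulli walks, Doob-transformed by the number of
    patterns below [y], which is proportional to [h_k y].

    The determinants [q_t] are the transition probabilities of the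
    killed-and-reflected walk: they satisfy its backward equation, because the
    rows are averaged by a coin, two coinciding [y]'s give equal rows, and
    reflecting a coordinate of [x] off [y_j] adds a multiple of row [y_j] to the
    row of that coordinate; and [q_0] is the identity. *)

(** * Interlacing and reflection *)

Definition strict k (y : 'rV[int]_k) : bool :=
  [forall i : 'I_k, forall j : 'I_k, (i < j)%N ==> (y ord0 i < y ord0 j)].

Definition interl n (x : 'rV[int]_n.+1) (y : 'rV[int]_n) : bool :=
  [forall i : 'I_n, x ord0 (lift ord_max i) <= y ord0 i < x ord0 (lift ord0 i)].

Definition jump k (x : 'rV[int]_k) (b : {ffun 'I_k -> bool}) : 'rV[int]_k :=
  \row_i (x ord0 i + (b i)%:R).

(* Particle [i] of the upper line is blocked from above by particle [i] and
   pushed from below by particle [i - 1] of the lower line; [unlift] yields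
   [None] where that wall is absent. *)
Definition push1 n (y : 'rV[int]_n) (i : 'I_n.+1) (z : int) : int :=
  z - (oapp (fun j => z == y ord0 j + 1) false (unlift ord_max i))%:R
    + (oapp (fun j => z == y ord0 j) false (unlift ord0 i))%:R.

Definition pushed n (z : 'rV[int]_n.+1) (y : 'rV[int]_n) : 'rV[int]_n.+1 :=
  \row_i push1 y i (z ord0 i).

Lemma interlP n (x : 'rV[int]_n.+1) (y : 'rV[int]_n) :
  reflect (interlaced x y) (interl x y).
Proof. exact: forallP. Qed.

Lemma strictP k (y : 'rV[int]_k) :
  reflect (forall i j : 'I_k, (i < j)%N -> y ord0 i < y ord0 j) (strict y).
Proof.
apply: (iffP forallP) => [H i j ij|H i].
  by move/forallP/(_ j): (H i); rewrite ij.
by apply/forallP => j; apply/implyP; exact: H.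
Qed.

Lemma interl_strict_top n (x : 'rV[int]_n.+1) (y : 'rV[int]_n) :
  interl x y -> strict x.
Proof.
move=> /forallP H; apply/strictP.
suff Hd d (i j : 'I_n.+1) : (j = i + d.+1 :> nat)%N -> x ord0 i < x ord0 j.
  by move=> i j ij; apply: (Hd (j - i).-1); lia.
elim: d j => [|d IH] j ji.
  have lt_in : (i < n)%N by have := ltn_ord j; lia.
  have := H (Ordinal lt_in).
  have -> : lift ord_max (Ordinal lt_in) = i by apply: val_inj; rewrite /= /bump; lia.
  have -> : lift ord0 (Ordinal lt_in) = j by apply: val_inj; rewrite /= /bump; lia.
  by move=> /andP[]; exact: le_lt_trans.
have lt_jn : (j.-1 < n)%N by have := ltn_ord j; lia.
have := H (Ordinal lt_jn).
have -> : lift ord0 (Ordinal lt_jn) = j by apply: val_inj; rewrite /= /bump; lia.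
move=> /andP[]/le_lt_trans h /h; apply: lt_trans; apply: IH.
by rewrite /= /bump; lia.
Qed.

Variant right_wall_spec n (i : 'I_n.+1) : option 'I_n -> Type :=
| RightWall (j : 'I_n) of i = lift ord_max j & i = j :> nat : right_wall_spec i (Some j)
| NoRightWall of i = n :> nat : right_wall_spec i None.

Variant left_wall_spec n (i : 'I_n.+1) : option 'I_n -> Type :=
| LeftWall (j : 'I_n) of i = lift ord0 j & i = j.+1 :> nat : left_wall_spec i (Some j)
| NoLeftWall of i = 0%N :> nat : left_wall_spec i None.

Lemma right_wallP n (i : 'I_n.+1) : right_wall_spec i (unlift ord_max i).
Proof.
case: unliftP => [j ij|->]; constructor=> //.
by rewrite ij lift_max.
Qed.

Lemma left_wallP n (i : 'I_n.+1) : left_wall_spec i (unlift ord0 i).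
Proof.
case: unliftP => [j ij|->]; constructor=> //.
by rewrite ij lift0.
Qed.

Lemma interl_strict n (x : 'rV[int]_n.+1) (y : 'rV[int]_n) :
  interl x y -> strict y.
Proof.
move=> xy; have /strictP sx := interl_strict_top xy.
move/interlP: xy => H; apply/strictP => i j ij.
have /andP[_ h1] := H i; have /andP[h2 _] := H j.
apply: (lt_le_trans h1); apply: le_trans h2.
have [->//|ne] := eqVneq (lift ord0 i) (lift ord_max j).
apply/ltW/sx; move: ne; rewrite -val_eqE /= /bump.
have := ltn_ord j; lia.
Qed.

(** An upper particle starts on the right side of its walls and every jump is at most one, so after
    the jumps it violates a wall by at most one unit, which [push1] corrects. Strictness of the new
    lower row keeps the two corrections from acting on the same particle. *)
Lemma pushed_interl n (x : 'rV[int]_n.+1) (y : 'rV[int]_n) b g :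
  interl x y -> strict (jump y g) ->
  interl (pushed (jump x b) (jump y g)) (jump y g).
Proof.
move=> /interlP H /strictP s; apply/interlP => i; have /andP[h1 h2] := H i.
rewrite !mxE /push1; apply/andP; split.
  rewrite liftK /=.
  case: left_wallP => [j _|_] /=; rewrite ?mxE.
    rewrite /= /bump => e; have /s : (j < i)%N by have := ltn_ord i; lia.
    rewrite !mxE; case: (b _); case: (g i); case: (g j) => /=; lia.
  case: (b _); case: (g i) => /=; lia.
rewrite liftK /=.
case: right_wallP => [j _|_] /=; rewrite ?mxE.
  rewrite /= /bump => e; have /s : (i < j)%N by have := ltn_ord i; lia.
  rewrite !mxE; case: (b _); case: (g i); case: (g j) => /=; lia.
case: (b _); case: (g i) => /=; lia.
Qed.

(** The right wall can block only a particle whose coin is 1, and the left wall can push only one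
    whose coin is 0, so the corrected displacement is again 0 or 1. *)
Lemma pushed_jump n (x : 'rV[int]_n.+1) (y : 'rV[int]_n) b g :
  interl x y -> strict (jump y g) ->
  exists b', pushed (jump x b) (jump y g) = jump x b'.
Proof.
move=> /interlP H /strictP s.
exists [ffun i => pushed (jump x b) (jump y g) ord0 i == x ord0 i + 1].
apply/rowP => i; rewrite !mxE ffunE !mxE /push1.
case: (right_wallP i) => [j e1 e1'|e1]; case: (left_wallP i) => [j' e2 e2'|e2] /=;
  rewrite ?mxE.
- have /andP[h1 _] := H j; have /andP[_ h2] := H j'.
  rewrite -e1 in h1; rewrite -e2 in h2.
  have /s : (j' < j)%N by lia.
  rewrite !mxE; case: (b _); case: (g j'); case: (g j) => /=; lia.
- have /andP[h1 _] := H j; rewrite -e1 in h1.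
  case: (b _); case: (g j) => /=; lia.
- have /andP[_ h2] := H j'; rewrite -e2 in h2.
  case: (b _); case: (g j') => /=; lia.
- by case: (b _) => /=; lia.
Qed.

(** * Intertwining of two consecutive lines *)

(** Grouping terms by their value shows that point masses determine a finite measure. This turns
    [intertwining] into a count for each target pair. *)
Lemma eq_sum_point_masses (R : comPzRingType) (E : eqType) (I J : Type)
    (r : seq I) (r' : seq J) (w : I -> R) (w' : J -> R) (p : I -> E) (p' : J -> E) :
  (forall e, \sum_(i <- r) w i * (p i == e)%:R = \sum_(j <- r') w' j * (p' j == e)%:R) ->
  forall f : E -> R,
    \sum_(i <- r) w i * f (p i) = \sum_(j <- r') w' j * f (p' j).
Proof.
move=> H f; pose S := undup (map p r ++ map p' r').
have fE e : e \in S -> f e = \sum_(s <- S) (e == s)%:R * f s.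
  move=> eS; rewrite (bigD1_seq e) ?undup_uniq //= eqxx mul1r big1 ?addr0 // => s se.
  by rewrite eq_sym (negbTE se) mul0r.
have expand (K : Type) (t : seq K) (v : K -> R) (q : K -> E) :
    {subset map q t <= S} ->
    \sum_(i <- t) v i * f (q i) = \sum_(s <- S) f s * \sum_(i <- t) v i * (q i == s)%:R.
  move=> tS; transitivity (\sum_(i <- t) \sum_(s <- S) f s * (v i * (q i == s)%:R)).
    elim: t tS => [|a t IH] tS; rewrite ?big_nil // !big_cons IH; last first.
      by move=> e et; apply: tS; rewrite inE et orbT.
    congr (_ + _); rewrite {1}(fE (q a)); last by apply: tS; rewrite inE eqxx.
    by rewrite mulr_sumr; apply: eq_bigr => s _; ring.
  by rewrite exchange_big; apply: eq_bigr => s _; rewrite mulr_sumr.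
rewrite !expand; first by apply: eq_bigr => s _; rewrite H.
  by move=> e; rewrite mem_undup mem_cat => ->; rewrite orbT.
by move=> e; rewrite mem_undup mem_cat => ->.
Qed.

Lemma natr_forall (R : comPzRingType) (I : finType) (P : pred I) :
  [forall i, P i]%:R = \prod_i (P i)%:R :> R.
Proof.
case: forallP => [H|/forallP H].
  by rewrite big1 // => i _; rewrite H.
have /existsP[i Pi] : [exists i, ~~ P i] by rewrite -negb_forall.
by rewrite (bigD1 i) //= (negbTE Pi) mul0r.
Qed.

Lemma prod_lift_max (R : comPzRingType) n (F : 'I_n.+1 -> R) :
  \prod_i F i = (\prod_(j < n) F (lift ord_max j)) * F ord_max.
Proof.
rewrite big_ord_recr /=; congr (_ * _); apply: eq_bigr => j _; congr F.
by apply: val_inj; rewrite /= /bump; have := ltn_ord j; lia.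
Qed.

Lemma row_ext (R : Type) n (x y : 'rV[R]_n) :
  (forall i, x ord0 i = y ord0 i) -> x = y.
Proof. by move=> H; apply/rowP. Qed.

Definition gap n (x : 'rV[int]_n.+1) (i : 'I_n) : nat :=
  `|(x ord0 (lift ord0 i) - x ord0 (lift ord_max i))%R|%N.

(** Rows below [x] are encoded by choice functions into one common bound, so that a sum over them
    distributes over the coordinates in [sum_gt_count]. *)
Definition offsets n (x : 'rV[int]_n.+1) :
    pred {ffun 'I_n -> 'I_(\max_i gap x i)} :=
  family (fun i => [pred a : 'I__ | (a < gap x i)%N]).

Arguments offsets {n} x _.

Definition offset_row n (x : 'rV[int]_n.+1) (f : {ffun 'I_n -> 'I_(\max_i gap x i)}) :
    'rV[int]_n := \row_i (x ord0 (lift ord_max i) + (f i : nat)%:Z).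

Definition below n (x : 'rV[int]_n.+1) : seq 'rV[int]_n :=
  [seq offset_row f | f in offsets x].

Lemma gapE n (x : 'rV[int]_n.+1) i : strict x ->
  (gap x i)%:Z = x ord0 (lift ord0 i) - x ord0 (lift ord_max i).
Proof.
move=> /strictP s; have /s : (lift ord_max i < lift ord0 i)%N.
  by rewrite /= /bump; have := ltn_ord i; lia.
rewrite /gap; lia.
Qed.

Lemma mem_below n (x : 'rV[int]_n.+1) (y : 'rV[int]_n) : strict x -> (y \in below x) = interl x y.
Proof.
move=> s; apply/fintype.imageP/interlP => [[f /familyP Hf ->] i|H].
  by rewrite mxE lerDl lez_nat /= -ltrBrDl -gapE // ltz_nat; exact: (Hf i).
have lt_gap (i : 'I_n) : (`|(y ord0 i - x ord0 (lift ord_max i))%R|%N < gap x i)%N.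
  by have := H i; have e := gapE i s; rewrite /gap in e *; lia.
have lt_max i := leq_trans (lt_gap i) (leq_bigmax i).
exists [ffun i => Ordinal (lt_max i)].
  by apply/familyP => i; rewrite ffunE inE /= lt_gap.
by apply: row_ext => i; rewrite mxE ffunE /=; have := H i; lia.
Qed.

Lemma below_uniq n (x : 'rV[int]_n.+1) : uniq (below x).
Proof.
rewrite map_inj_uniq ?enum_uniq // => f g /rowP fg; apply/ffunP => i.
by apply: val_inj; have := fg i; rewrite !mxE /=; lia.
Qed.

Definition unjump k (y : 'rV[int]_k) (g : {ffun 'I_k -> bool}) : 'rV[int]_k :=
  \row_i (y ord0 i - (g i)%:R).

Lemma unjumpK k (g : {ffun 'I_k -> bool}) : cancel (@unjump k ^~ g) (@jump k ^~ g).
Proof. by move=> y; apply/rowP => i; rewrite !mxE subrK. Qed.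

Lemma jumpK k (g : {ffun 'I_k -> bool}) : cancel (@jump k ^~ g) (@unjump k ^~ g).
Proof. by move=> y; apply/rowP => i; rewrite !mxE addrK. Qed.

Lemma sum_uniq_pick (R : pzRingType) (E : eqType) (r : seq E) (e : E) (F : E -> R) :
  uniq r -> \sum_(i <- r | i == e) F i = (e \in r)%:R * F e.
Proof.
move=> u; case er: (e \in r).
  rewrite mul1r big_mkcond (bigD1_seq e er u) /= eqxx big1 ?addr0 // => i.
  by move=> /negbTE ->.
rewrite mul0r big_seq_cond big1 // => i /andP[ir /eqP ie].
by rewrite -ie ir in er.
Qed.

(** The condition on coordinate [i] involves the coin [g i] only, so the sum over coin vectors is a
    product of sums over a single coin. The same holds for [sum_pushed]. *)
Lemma sum_interl_unjump (R : comPzRingType) n (x : 'rV[int]_n.+1) (y : 'rV[int]_n) :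
  \sum_(g : {ffun 'I_n -> bool}) (interl x (unjump y g))%:R =
  \prod_(i < n) ((x ord0 (lift ord_max i) <= y ord0 i - 1 < x ord0 (lift ord0 i))%R%:R +
      (x ord0 (lift ord_max i) <= y ord0 i < x ord0 (lift ord0 i))%R%:R) :> R.
Proof.
pose F i (c : bool) : R := (x ord0 (lift ord_max i) <= y ord0 i - c%:R < x ord0 (lift ord0 i))%R%:R.
transitivity (\prod_i \sum_(c : bool) F i c); last first.
  by apply: eq_bigr => i _; rewrite big_bool /F subr0.
rewrite bigA_distr_bigA; apply: eq_bigr => g _; rewrite /interl natr_forall.
by apply: eq_bigr => i _; rewrite mxE.
Qed.

Lemma sum_pushed (R : comPzRingType) n (x x' : 'rV[int]_n.+1) (y : 'rV[int]_n) :
  \sum_(b : {ffun 'I_n.+1 -> bool}) (pushed (jump x b) y == x')%:R =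
  \prod_i ((push1 y i (x ord0 i + 1) == x' ord0 i)%:R +
           (push1 y i (x ord0 i) == x' ord0 i)%:R) :> R.
Proof.
pose F i (c : bool) : R := (push1 y i (x ord0 i + c%:R) == x' ord0 i)%:R.
transitivity (\prod_i \sum_(c : bool) F i c); last first.
  by apply: eq_bigr => i _; rewrite big_bool /F addr0.
rewrite bigA_distr_bigA; apply: eq_bigr => b _.
transitivity ([forall i, pushed (jump x b) y ord0 i == x' ord0 i]%:R : R).
  congr (nat_of_bool _)%:R; apply/eqP/forallP => [-> //|H].
  by apply: row_ext => i; apply/eqP.
by rewrite natr_forall; apply: eq_bigr => i _; rewrite !mxE.
Qed.

(* Writing [r_j] (resp. [l_j]) for the event that the wall [y'_j] is touched by
   the particle below (resp. above) it with two coins giving the same outcome,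
   the factor of [j] is [(2 - r_j - l_j) (1 + r_j) (1 + l_j) = 2], as [r_j] and
   [l_j] exclude each other. *)
Lemma intertwining_mass (R : comPzRingType) n (x : 'rV[int]_n.+1) (y' : 'rV[int]_n) g0 :
  strict x -> interl (jump x g0) y' ->
  (\sum_(g : {ffun 'I_n -> bool}) (interl x (unjump y' g))%:R) *
  (\sum_(b : {ffun 'I_n.+1 -> bool}) (pushed (jump x b) y' == jump x g0)%:R) = 2 ^+ n :> R.
Proof.
move=> /strictP sx xy'; have /strictP sy := interl_strict xy'.
move/interlP: xy' => H.
pose r i := oapp (fun j : 'I_n => (x ord0 i == y' ord0 j) && ~~ g0 i) false (unlift ord_max i).
pose l i := oapp (fun j : 'I_n => (x ord0 i == y' ord0 j) && g0 i) false (unlift ord0 i).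
(* Exactly one coin leads a particle to its target, unless a wall makes both work: coin 1 is blocked
   by the right wall ([r]), or coin 0 is pushed by the left wall ([l]). *)
have pushE i : (push1 y' i (x ord0 i + 1) == jump x g0 ord0 i)%:R +
           (push1 y' i (x ord0 i) == jump x g0 ord0 i)%:R = (1 + (r i)%:R) * (1 + (l i)%:R) :> R.
  rewrite /r /l /push1 mxE; set a := x ord0 i.
  case: (right_wallP i) => [j e1 e1'|e1]; case: (left_wallP i) => [j' e2 e2'|e2] /=.
  - have := H j; have := H j'; rewrite !mxE -e1 -e2 -/a.
    have /sy : (j' < j)%N by lia.
    case: (g0 i) => /= h1 /andP[_ h2] /andP[h3 _].
      have -> : (a + 1 - (a + 1 == y' ord0 j + 1)%:R + (a + 1 == y' ord0 j')%:R == a + 1) = true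
        by lia.
      have -> : (a - (a == y' ord0 j + 1)%:R + (a == y' ord0 j')%:R == a + 1) = (a == y' ord0 j')
        by lia.
      by rewrite andbF andbT ?mulr1n ?mulr0n; case: (a == _) => /=; ring.
    have -> : (a + 1 - (a + 1 == y' ord0 j + 1)%:R + (a + 1 == y' ord0 j')%:R == a + 0) =
        (a == y' ord0 j) by lia.
    have -> : (a - (a == y' ord0 j + 1)%:R + (a == y' ord0 j')%:R == a + 0) = true by lia.
    by rewrite andbF andbT ?mulr1n ?mulr0n; case: (a == _) => /=; ring.
  - have := H j; rewrite !mxE -e1 -/a.
    case: (g0 i) => /= /andP[h3 _].
      have -> : (a + 1 - (a + 1 == y' ord0 j + 1)%:R + 0 == a + 1) = true by lia.
      have -> : (a - (a == y' ord0 j + 1)%:R + 0 == a + 1) = false by lia.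
      by rewrite andbF /=; ring.
    have -> : (a + 1 - (a + 1 == y' ord0 j + 1)%:R + 0 == a + 0) = (a == y' ord0 j) by lia.
    have -> : (a - (a == y' ord0 j + 1)%:R + 0 == a + 0) = true by lia.
    by rewrite andbT ?mulr1n ?mulr0n; case: (a == _) => /=; ring.
  - have := H j'; rewrite !mxE -e2 -/a.
    case: (g0 i) => /= /andP[_ h2].
      have -> : (a + 1 - 0 + (a + 1 == y' ord0 j')%:R == a + 1) = true by lia.
      have -> : (a - 0 + (a == y' ord0 j')%:R == a + 1) = (a == y' ord0 j') by lia.
      by rewrite andbT ?mulr1n ?mulr0n; case: (a == _) => /=; ring.
    have -> : (a + 1 - 0 + (a + 1 == y' ord0 j')%:R == a + 0) = false by lia.
    have -> : (a - 0 + (a == y' ord0 j')%:R == a + 0) = true by lia.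
    by rewrite andbF /=; ring.
  - case: (g0 i) => /=.
      have -> : (a + 1 - 0 + 0 == a + 1) = true by lia.
      have -> : (a - 0 + 0 == a + 1) = false by lia.
      by rewrite /=; ring.
    have -> : (a + 1 - 0 + 0 == a + 0) = false by lia.
    have -> : (a - 0 + 0 == a + 0) = true by lia.
    by rewrite /=; ring.
(* The factors are regrouped by wall instead of by particle; the extreme particle without a wall
   contributes 1. *)
have prodr : \prod_i (1 + (r i)%:R) =
    \prod_(j < n) (1 + ((x ord0 (lift ord_max j) == y' ord0 j) && ~~ g0 (lift ord_max j))%:R) :> R.
  rewrite prod_lift_max /r unlift_none /= addr0 mulr1.
  by apply: eq_bigr => j _; rewrite liftK.
have prodl : \prod_i (1 + (l i)%:R) =
    \prod_(j < n) (1 + ((x ord0 (lift ord0 j) == y' ord0 j) && g0 (lift ord0 j))%:R) :> R.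
  rewrite big_ord_recl /l unlift_none /= addr0 mul1r.
  by apply: eq_bigr => j _; rewrite liftK.
rewrite sum_interl_unjump sum_pushed (eq_bigr _ (fun i _ => pushE i)) big_split /=.
rewrite prodr prodl -!big_split /=.
rewrite -[n in RHS](card_ord n) -prodr_const; apply: eq_bigr => j _.
have /sx : (lift ord_max j < lift ord0 j)%N by rewrite /= /bump; have := ltn_ord j; lia.
have := H j; rewrite !mxE.
set u := x ord0 (lift ord_max j); set v := x ord0 (lift ord0 j); set w := y' ord0 j.
move=> h1 h2.
(* The old position [w - 1] is lost exactly when the particle at [u = w] stays, and [w] exactly when
   the particle at [v = w] jumps. *)
have -> : (u <= w - 1 < v) = ~~ ((u == w) && ~~ g0 (lift ord_max j)).
  by move: h1; case: (g0 _); case: (g0 _) => /=; lia.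
have -> : (u <= w < v) = ~~ ((v == w) && g0 (lift ord0 j)).
  by move: h1; case: (g0 _); case: (g0 _) => /=; lia.
have : ~~ (((u == w) && ~~ g0 (lift ord_max j)) && ((v == w) && g0 (lift ord0 j))) by lia.
by case: ((u == w) && _); case: ((v == w) && _) => //= _; ring.
Qed.

Lemma jump_inj k (x : 'rV[int]_k) : injective (jump x).
Proof.
move=> g h /rowP gh; apply/ffunP => i; have := gh i; rewrite !mxE.
by move/addrI; case: (g i); case: (h i).
Qed.

(** Tested on a point mass at [(x', y')] with [y'] strict, the left side is the number of
    predecessors of [y'] interlacing with [x], times the number of coin vectors carrying [x] to [x']
    along the walls [y']. By [intertwining_mass] this is [2 ^+ n] if [x'] is a jump of [x]
    interlacing with [y']; otherwise it is 0. *)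
Lemma intertwining (R : comPzRingType) n (x : 'rV[int]_n.+1)
    (f : 'rV[int]_n.+1 -> 'rV[int]_n -> R) : strict x ->
  \sum_(y <- below x) \sum_(g : {ffun 'I_n -> bool} | strict (jump y g))
     \sum_(b : {ffun 'I_n.+1 -> bool}) f (pushed (jump x b) (jump y g)) (jump y g)
  = 2 ^+ n * \sum_(g : {ffun 'I_n.+1 -> bool} | strict (jump x g))
      \sum_(y <- below (jump x g)) f (jump x g) y.
Proof.
move=> sx.
pose I := ('rV[int]_n * ({ffun 'I_n -> bool} * {ffun 'I_n.+1 -> bool}))%type.
pose J := ({ffun 'I_n.+1 -> bool} * 'rV[int]_n)%type.
pose rI : seq I := [seq (y, gb) | y <- below x, gb <- index_enum _].
pose rJ : seq J := [seq (g, y) | g <- index_enum _, y <- below (jump x g)].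
pose wI (u : I) : R := (strict (jump u.1 u.2.1))%:R.
pose wJ (u : J) : R := 2 ^+ n * (strict (jump x u.1))%:R.
pose pI (u : I) := (pushed (jump x u.2.2) (jump u.1 u.2.1), jump u.1 u.2.1).
pose pJ (u : J) := (jump x u.1, u.2).
have LE (h : 'rV[int]_n.+1 * 'rV[int]_n -> R) :
    \sum_(u <- rI) wI u * h (pI u) =
    \sum_(y <- below x) \sum_(g : {ffun 'I_n -> bool} | strict (jump y g))
     \sum_(b : {ffun 'I_n.+1 -> bool}) h (pushed (jump x b) (jump y g), jump y g).
  rewrite big_allpairs_dep; apply: eq_bigr => y _ /=.
  transitivity (\sum_(g : {ffun 'I_n -> bool}) \sum_(b : {ffun 'I_n.+1 -> bool})
     wI (y, (g, b)) * h (pI (y, (g, b)))).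
    by rewrite pair_bigA /=; apply: eq_bigr => -[g b] _.
  rewrite [RHS]big_mkcond; apply: eq_bigr => g _.
  by rewrite /wI /= -mulr_sumr; case: ifP => _; rewrite ?mul1r ?mul0r.
have RE (h : 'rV[int]_n.+1 * 'rV[int]_n -> R) :
    \sum_(u <- rJ) wJ u * h (pJ u) =
    2 ^+ n * \sum_(g : {ffun 'I_n.+1 -> bool} | strict (jump x g))
      \sum_(y <- below (jump x g)) h (jump x g, y).
  rewrite big_allpairs_dep [in RHS]big_mkcond mulr_sumr; apply: eq_bigr => g _ /=.
  by rewrite /wJ /= -mulr_sumr -mulrA; case: ifP => _; rewrite ?mul1r ?mul0r.
pose f2 e := f e.1 e.2.
suff key : \sum_(u <- rI) wI u * f2 (pI u) = \sum_(u <- rJ) wJ u * f2 (pJ u).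
  by rewrite (LE f2) (RE f2) in key.
apply: eq_sum_point_masses.
move=> -[x' y'].
rewrite (LE (fun e => (e == _)%:R)) (RE (fun e => (e == _)%:R)).
(* Given the target [y'], the previous lower row is [unjump y' g], and the upper line sees only
   [y']; this separates the two counts. *)
transitivity (\sum_(g : {ffun 'I_n -> bool}) (interl x (unjump y' g))%:R *
    ((strict y')%:R * \sum_(b : {ffun 'I_n.+1 -> bool}) (pushed (jump x b) y' == x')%:R) : R).
  transitivity (\sum_(y <- below x) \sum_(g : {ffun 'I_n -> bool}) 
     (if y == unjump y' g then (strict y')%:R *
        \sum_(b : {ffun 'I_n.+1 -> bool}) (pushed (jump x b) y' == x')%:R else 0 : R)).
    apply: eq_bigr => y _; rewrite big_mkcond; apply: eq_bigr => g _.
    have [->|ne] := eqVneq y (unjump y' g).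
      rewrite unjumpK; case: ifP => _; rewrite ?mul0r ?mul1r //.
      by apply: eq_bigr => b _; rewrite xpair_eqE eqxx andbT.
    rewrite big1 ?if_same // => b _; rewrite xpair_eqE.
    have -> : (jump y g == y') = false by apply: contra_neqF ne => /eqP <-; rewrite jumpK.
    by rewrite andbF.
  rewrite exchange_big; apply: eq_bigr => g _.
  by rewrite -big_mkcond sum_uniq_pick ?below_uniq ?mem_below.
transitivity (2 ^+ n * \sum_(g : {ffun 'I_n.+1 -> bool}) ((jump x g == x') && interl x' y')%:R : R);
  last first.
  congr (_ * _); rewrite [RHS]big_mkcond; apply: eq_bigr => g _.
  have [<-|ne] /= := eqVneq (jump x g) x'; last first.
    by rewrite big1 ?if_same // => y _; rewrite xpair_eqE (negbTE ne).
  case: ifP => sg; last by case: (boolP (interl _ _)) => // /interl_strict_top; rewrite sg.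
  transitivity (\sum_(y <- below (jump x g) | y == y') (1 : R)).
    by rewrite sum_uniq_pick ?below_uniq // mem_below // mulr1.
  rewrite big_mkcond; apply: eq_bigr => y _; rewrite xpair_eqE eqxx /=.
  by case: eqP.
have [/existsP[g0 /andP[/eqP <- xy']]|no] :=
    boolP [exists g : {ffun 'I_n.+1 -> bool}, (jump x g == x') && interl x' y'].
  rewrite -mulr_suml (interl_strict xy') mul1r intertwining_mass // (bigD1 g0) //= eqxx xy'.
  rewrite big1 ?addr0 ?mulr1 // => g ne; rewrite (inj_eq (@jump_inj _ x)).
  by rewrite (negbTE ne).
rewrite [in RHS]big1 ?mulr0; last first.
  by move=> g _; case: andP => // gP; case/existsP: no; exists g; apply/andP.
rewrite big1 // => g _; case: (boolP (interl _ _)) => [xy|_]; last by rewrite mul0r.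
case: (boolP (strict y')) => [sy|_]; last by rewrite mul0r mulr0.
(* A pushed row equal to [x'] would make [x'] a jump of [x] interlacing with [y'], which is the
   excluded case. *)
rewrite big1 ?mulr0 // => b _; case: eqP => // e; case/negP: no.
have := pushed_jump b xy (g := g); rewrite unjumpK => /(_ sy) [b' eb].
apply/existsP; exists b'; rewrite -eb e eqxx /= -e.
by have := pushed_interl b xy (g := g); rewrite unjumpK; apply.
Qed.

(** * Counting Gelfand-Tsetlin patterns *)

(** The binomial coefficient [u] choose [i] as a polynomial in [u]: its forward difference lowers
    [i] by one, so sums over a gap telescope. *)
Definition binom_poly (R : numFieldType) (i : nat) : {poly R} :=
  (i`!%:R)^-1 *: \prod_(a < i) ('X - (a%:R)%:P).

Lemma horner_binom_poly (R : numFieldType) i (u : R) :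
  (binom_poly R i).[u] = (i`!%:R)^-1 * \prod_(a < i) (u - a%:R).
Proof.
by rewrite hornerZ horner_prod; congr (_ * _); apply: eq_bigr => a _; rewrite hornerXsubC.
Qed.

Lemma binom_polyS (R : numFieldType) i (u : R) :
  (binom_poly R i.+1).[u + 1] - (binom_poly R i.+1).[u] = (binom_poly R i).[u].
Proof.
rewrite !horner_binom_poly -mulrBr big_ord_recl big_ord_recr /=.
rewrite (eq_bigr (fun a : 'I_i => u - a%:R)); last first.
  by move=> a _; rewrite /bump /= natrD; ring.
rewrite factS natrM; have : (i`!%:R : R) != 0 by rewrite pnatr_eq0; have := fact_gt0 i; lia.
have : (i.+1%:R : R) != 0 by rewrite pnatr_eq0.
have -> : (i.+1%:R : R) = i%:R + 1 by rewrite -natr1.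
by move=> h1 h2; field; apply/andP.
Qed.

Lemma size_binom_poly (R : numFieldType) i : size (binom_poly R i) = i.+1.
Proof.
rewrite size_scale ?size_prod_XsubC ?invr_eq0 ?pnatr_eq0; last by have := fact_gt0 i; lia.
by rewrite /index_enum -enumT size_enum_ord.
Qed.

Lemma lead_coef_binom_poly (R : numFieldType) i : lead_coef (binom_poly R i) = (i`!%:R)^-1.
Proof. by rewrite lead_coefZ (monicP (monic_prod_XsubC _ _ _)) mulr1. Qed.

(** For strict [y] this is the number of Gelfand-Tsetlin patterns with top row [y] ([gt_sum1]). *)
Definition gt_count (R : numFieldType) k (y : 'rV[int]_k) : R :=
  \det (\matrix_(i < k, j < k) (binom_poly R j).[(y ord0 i)%:~R]).

(** Passing from monomials to binomial polynomials is a triangular change of basis with diagonal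
    entries [1 / i!], so the two determinants differ by a nonzero constant factor. *)
Lemma gt_count_vandermonde (R : realType) k :
  exists2 c : R, c != 0 & forall y : 'rV[int]_k, gt_count R y = c * vandermonde R y.
Proof.
pose C : 'M[R]_k := \matrix_(l, j) (binom_poly R j)`_l.
exists (\det C) => [|y].
  rewrite -det_tr det_trig; last first.
    apply/is_trig_mxP => i j ij; rewrite !mxE nth_default // size_binom_poly //.
  apply/prodf_neq0 => i _; rewrite !mxE.
  have -> : (binom_poly R i)`_i = lead_coef (binom_poly R i).
    by rewrite lead_coefE size_binom_poly.
  by rewrite lead_coef_binom_poly invr_eq0 pnatr_eq0; have := fact_gt0 i; lia.
pose a : 'rV[R]_k := \row_j (y ord0 j)%:~R.
have -> : vandermonde R y = \det (Vandermonde k a).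
  rewrite det_Vandermonde; apply: eq_bigr => i _; apply: eq_bigr => j _.
  by rewrite !mxE rmorphB.
rewrite -(det_tr (Vandermonde k a)) mulrC -det_mulmx; congr (\det _).
apply/matrixP => i j; rewrite !mxE (@horner_coef_wide _ k); last first.
  by rewrite size_binom_poly.
by apply: eq_bigr => l _; rewrite !mxE mulrC.
Qed.

(** Subtracting from each row the preceding one, by the unitriangular [L], turns the first column of
    ones into the first unit vector; expanding along it leaves the differences. *)
Lemma det_differences (R : comNzRingType) n (A : 'M[R]_n.+1) :
  (forall i, A i ord0 = 1) ->
  \det A = \det (\matrix_(i < n, j < n)
    (A (lift ord0 i) (lift ord0 j) - A (lift ord_max i) (lift ord0 j))).
Proof.
move=> A1; pose L : 'M[R]_n.+1 := \matrix_(i, j) ((i == j)%:R - (i == j.+1 :> nat)%:R).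
have detL : \det L = 1.
  rewrite det_trig.
    by rewrite big1 // => i _; rewrite mxE eqxx (ltn_eqF (ltnSn i)) subr0.
  apply/is_trig_mxP => i j ij; rewrite mxE -val_eqE /=.
  by rewrite (ltn_eqF ij) (ltn_eqF (ltnW ij : (i < j.+1)%N)) subr0.
have pick (B : 'I_n.+1 -> R) (i : 'I_n.+1) : \sum_(j < n.+1) (i == j)%:R * B j = B i.
  rewrite (bigD1 i) //= eqxx mul1r big1 ?addr0 // => j ji.
  by rewrite eq_sym (negbTE ji) mul0r.
have LA0 j : (L *m A) ord0 j = A ord0 j.
  rewrite mxE (eq_bigr (fun l => (ord0 == l)%:R * A l j)) ?pick // => l _.
  by rewrite mxE /= subr0.
have LAS (i : 'I_n) (j : 'I_n.+1) :
    (L *m A) (lift ord0 i) j = A (lift ord0 i) j - A (lift ord_max i) j.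
  rewrite mxE; rewrite (eq_bigr (fun l => (lift ord0 i == l)%:R * A l j -
     (lift ord_max i == l)%:R * A l j)).
    by rewrite sumrB !pick.
  move=> l _; rewrite mxE mulrBl; congr (_ - (_%:R * _)).
  by rewrite -[in RHS]val_eqE /= /bump; have := ltn_ord i; lia.
rewrite -[LHS]mul1r -detL -det_mulmx (expand_det_col _ ord0) (bigD1 ord0) //=.
rewrite big1 ?addr0; last first.
  move=> i; case: (unliftP ord0 i) => [j ->|->] // _.
  by rewrite LAS !A1 subrr mul0r.
rewrite LA0 A1 mul1r /cofactor addn0 expr0 mul1r; congr (\det _).
by apply/matrixP => i j; rewrite 2!mxE LAS mxE.
Qed.

(** Row [i] of the determinant depends on [y_i] alone, so the sum over interlacing [y] is taken row
    by row. Each sum telescopes by [binom_polyS] to a difference of consecutive rows for [x], and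
    [det_differences] reassembles them. *)
Lemma sum_gt_count (R : numFieldType) n (x : 'rV[int]_n.+1) : strict x ->
  \sum_(y <- below x) gt_count R y = gt_count R x.
Proof.
move=> sx; rewrite [RHS]/gt_count det_differences; last first.
  by move=> i; rewrite mxE horner_binom_poly big_ord0 fact0 invr1 mulr1.
rewrite big_image /= [RHS]/determinant.
rewrite (eq_bigr (fun f : {ffun 'I_n -> 'I_(\max_i gap x i)} => \sum_(s : 'S_n) (-1) ^+ s *
   \prod_i (binom_poly R (s i)).[(x ord0 (lift ord_max i) + (f i : nat)%:Z)%:~R])); last first.
  move=> f _; apply: eq_bigr => s _; congr (_ * _); apply: eq_bigr => i _; rewrite !mxE //.
rewrite exchange_big; apply: eq_bigr => s _; rewrite -mulr_sumr; congr (_ * _).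
pose F i (a : 'I_(\max_i gap x i)) :=
  (binom_poly R (s i)).[(x ord0 (lift ord_max i) + (a : nat)%:Z)%:~R].
transitivity (\sum_(f in offsets x) \prod_i F i (f i)) => //.
rewrite -bigA_distr_big_dep /=; apply: eq_bigr => i _.
pose H a := (binom_poly R (s i).+1).[(x ord0 (lift ord_max i) + (a : nat)%:Z)%:~R].
pose B (a : nat) := (binom_poly R (s i)).[(x ord0 (lift ord_max i) + a%:Z)%:~R].
transitivity (\sum_(a < gap x i) (H a.+1 - H a)).
  rewrite (eq_bigr (fun a : 'I_(gap x i) => B a)); last first.
    move=> a _; rewrite /H -[RHS]binom_polyS; congr (_.[_] - _).
    by rewrite -(addn1 a) PoszD addrA rmorphD.
  by rewrite [RHS](big_ord_widen _ B (leq_bigmax i)).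
rewrite -(big_mkord xpredT (fun a => H a.+1 - H a)) telescope_sumr // /H gapE // !mxE.
have -> : forall u v : int, u + (v - u) = v by move=> u v; ring.
by have -> : x ord0 (lift ord_max i) + 0%:Z = x ord0 (lift ord_max i) by rewrite addr0.

Qed.

(** * Evolution of uniform patterns *)

(* Rows of lengths 1, ..., k; interlacing is not built in, it is imposed by
   [gt_sum]. *)
Fixpoint pattern (k : nat) : Type :=
  if k is k'.+1 then (pattern k' * 'rV[int]_k'.+1)%type else unit.

Definition top k : pattern k -> 'rV[int]_k :=
  if k is k'.+1 then fun z => z.2 else fun=> 0.

Fixpoint coin_table (k : nat) : finType :=
  if k is k'.+1 then (coin_table k' * {ffun 'I_k'.+1 -> bool})%type : finType
  else unit : finType.

Fixpoint step k : pattern k -> coin_table k -> pattern k :=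
  if k is k'.+1 then fun z c =>
    let z' := step z.1 c.1 in (z', pushed (jump z.2 c.2) (top z'))
  else fun z _ => z.

Definition mean (R : numFieldType) (T : finType) (f : T -> R) : R :=
  #|T|%:R^-1 * \sum_c f c.

Definition evolve (R : numFieldType) k (F : pattern k -> R) (z : pattern k) : R :=
  mean (fun c => F (step z c)).

(** The integral of [F] against the unnormalized uniform measure on the interlacing patterns with a
    given top row. *)
Fixpoint gt_sum (R : numFieldType) k : 'rV[int]_k -> (pattern k -> R) -> R :=
  if k is k'.+1 then fun x F => \sum_(y <- below x) gt_sum y (fun z => F (z, x))
  else fun _ F => F tt.

Lemma eq_gt_sum (R : numFieldType) k (x : 'rV[int]_k) (F F' : pattern k -> R) :
  (forall z, top z = x -> F z = F' z) -> gt_sum x F = gt_sum x F'.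
Proof.
elim: k x F F' => [|k IH] x F F' H; first by apply: H; rewrite [x]thinmx0.
by apply: eq_bigr => y _; apply: IH => z _; apply: H.
Qed.

Lemma gt_sum_sum (R : numFieldType) k (x : 'rV[int]_k) (I : Type) (r : seq I)
    (F : I -> pattern k -> R) :
  gt_sum x (fun z => \sum_(i <- r) F i z) = \sum_(i <- r) gt_sum x (F i).
Proof.
elim: k x F => [|k IH] x F //=; rewrite exchange_big.
by apply: eq_bigr => y _; rewrite IH.
Qed.

Lemma gt_sumZ (R : numFieldType) k (x : 'rV[int]_k) (a : R) (F : pattern k -> R) :
  gt_sum x (fun z => a * F z) = a * gt_sum x F.
Proof.
elim: k x F => [|k IH] x F //=; rewrite mulr_sumr.
by apply: eq_bigr => y _; rewrite IH.
Qed.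

Lemma gt_sum1 (R : numFieldType) k (x : 'rV[int]_k) :
  strict x -> gt_sum x (fun=> 1) = gt_count R x.
Proof.
elim: k x => [|k IH] x sx; first by rewrite /gt_count det_mx00.
rewrite -sum_gt_count //= big_seq [RHS]big_seq; apply: eq_bigr => y.
by rewrite mem_below // => /interl_strict /IH.
Qed.

Lemma mean_pair (R : numFieldType) (S T : finType) (f : S * T -> R) :
  mean f = mean (fun s => mean (fun t => f (s, t))).
Proof.
rewrite /mean card_prod natrM invfM -mulrA; congr (_ * _).
rewrite -mulr_sumr; congr (_ * _).
by rewrite pair_bigA; apply: eq_bigr => -[].
Qed.

Lemma card_coins k : #|{ffun 'I_k -> bool}| = (2 ^ k)%N.
Proof. by rewrite card_ffun card_bool card_ord. Qed.

(** The intertwining of the lower rows is taken as a hypothesis, so that the computation serves both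
    inside the induction of [gt_sum_evolve] and after it. *)
Lemma gt_sum_evolve_pair_of (R : numFieldType) k (x : 'rV[int]_k.+1)
    (y : 'rV[int]_k) (F : pattern k.+1 -> R) :
  (forall F' : pattern k -> R, gt_sum y (evolve F') = 2 ^- k *
     \sum_(g : {ffun 'I_k -> bool} | strict (jump y g)) gt_sum (jump y g) F') ->
  gt_sum y (fun z => evolve F (z, x)) = 2 ^- (k + k.+1) *
    \sum_(g : {ffun 'I_k -> bool} | strict (jump y g))
     \sum_(b : {ffun 'I_k.+1 -> bool})
       gt_sum (jump y g) (fun z => F (z, pushed (jump x b) (jump y g))).
Proof.
move=> H.
pose F' z := mean (fun b : {ffun 'I_k.+1 -> bool} => F (z, pushed (jump x b) (top z))).
rewrite (@eq_gt_sum _ _ _ _ (evolve F')); last first.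
  by move=> z _; rewrite /evolve mean_pair.
rewrite H exprD invfM -mulrA; congr (_ * _); rewrite mulr_sumr.
apply: eq_bigr => g _; rewrite gt_sumZ card_coins natrX; congr (_ * _).
rewrite gt_sum_sum; apply: eq_bigr => b _.
by apply: eq_gt_sum => z ->.
Qed.

(** The induction hypothesis moves the pattern with top row [y], and [intertwining] turns the sum
    over jumps of [y] into one over jumps of [x]; its factor [2 ^+ k] absorbs the weight of the
    coins of the lower row. *)
Lemma gt_sum_evolve (R : numFieldType) k (x : 'rV[int]_k) (F : pattern k -> R) :
  strict x ->
  gt_sum x (evolve F) =
    2 ^- k * \sum_(g : {ffun 'I_k -> bool} | strict (jump x g)) gt_sum (jump x g) F.
Proof.
elim: k x F => [|k IH] x F sx.
  have strict0 (g : {ffun 'I_0 -> bool}) : strict (jump x g) by apply/strictP => -[].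
  rewrite (eq_bigl (mem {ffun 'I_0 -> bool})); last by move=> g; rewrite strict0.
  rewrite /= sumr_const card_coins expr0 invr1 mul1r mulr1n /evolve /mean.
  by rewrite (_ : #|_| = 1%N) ?card_unit // invr1 mul1r (big_pred1 tt) // => -[].
transitivity (\sum_(y <- below x) 2 ^- (k + k.+1) *
    \sum_(g : {ffun 'I_k -> bool} | strict (jump y g))
     \sum_(b : {ffun 'I_k.+1 -> bool})
       gt_sum (jump y g) (fun z => F (z, pushed (jump x b) (jump y g)))).
  rewrite /= big_seq [RHS]big_seq; apply: eq_bigr => y.
  rewrite mem_below // => /interl_strict sy; apply: gt_sum_evolve_pair_of => F'.
  exact: IH.
rewrite -mulr_sumr (intertwining (fun x y => gt_sum y (fun z => F (z, x)))) // mulrA.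
congr (_ * _); rewrite exprD invfM mulrAC mulVf ?mul1r //.
Qed.

Lemma gt_sum_evolve_pair (R : numFieldType) k (x : 'rV[int]_k.+1)
    (y : 'rV[int]_k) (F : pattern k.+1 -> R) : strict y ->
  gt_sum y (fun z => evolve F (z, x)) = 2 ^- (k + k.+1) *
    \sum_(g : {ffun 'I_k -> bool} | strict (jump y g))
     \sum_(b : {ffun 'I_k.+1 -> bool})
       gt_sum (jump y g) (fun z => F (z, pushed (jump x b) (jump y g))).
Proof. by move=> sy; apply: gt_sum_evolve_pair_of => F'; exact: gt_sum_evolve. Qed.

(** * The kernels *)

Lemma fsum_seq (R : realType) (I : choiceType) (D : set I) (r : seq I) (f : I -> R) :
  uniq r -> [set` r] `<=` D -> (forall i, D i -> i \notin r -> f i = 0) ->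
  \sum_(i \in D) f i = \sum_(i <- r) f i.
Proof.
move=> ur rD f0; rewrite (fsbig_seq _ _ ur); apply/esym/fsbig_widen => // i [Di ri].
by apply: f0 => //; apply/negP.
Qed.

Lemma convolution_phi (R : realType) (f : int -> R) z :
  convolution f (@phi R) z = 2^-1 * (f z + f (z - 1)).
Proof.
rewrite /convolution (@fsum_seq _ _ _ [:: z; z - 1]) //.
- rewrite !big_cons big_nil /phi /delta.
  have -> : (z - z == 0) = true by lia.
  have -> : (z - z == 1) = false by lia.
  have -> : (z - (z - 1) == 0) = false by lia.
  have -> : (z - (z - 1) == 1) = true by lia.
  by rewrite /=; ring.
- by rewrite /= andbT inE; lia.
move=> u _; rewrite !inE negb_or => /andP[u1 u2]; rewrite /phi /delta.
have -> : (z - u == 0) = false by lia.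
have -> : (z - u == 1) = false by lia.
by rewrite /=; ring.
Qed.

Lemma phi_iterS (R : realType) t z :
  phi_iter R t.+1 z = 2^-1 * (phi_iter R t z + phi_iter R t (z - 1)).
Proof. exact: convolution_phi. Qed.

Lemma phi_iter_lt0 (R : realType) t z : z < 0 -> phi_iter R t z = 0.
Proof.
elim: t z => [|t IH] z z0; first by rewrite /= /delta lt_eqF.
by rewrite phi_iterS !IH ?addr0 ?mulr0 //; lia.
Qed.

Lemma Delta_inv_nat (R : realType) (f : int -> R) (n : nat) z :
  (forall u, u < 0 -> f u = 0) ->
  (forall u, 0 <= u -> (u <= z) = (u < n%:Z)) ->
  Delta_inv f z = \sum_(i < n) f i%:Z.
Proof.
move=> f0 H; rewrite /Delta_inv (@fsum_seq _ _ _ [seq Posz i | i <- iota 0 n]).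
- by rewrite big_map -[n in LHS]subn0 big_mkord.
- by rewrite map_inj_uniq ?iota_uniq // => i j [].
- move=> u /= /mapP[i]; rewrite mem_iota => /andP[_ li] ->.
  by rewrite H //; lia.
move=> u /= uz; apply: contraNeq => fu.
case: (ltrP u 0) => [/f0 e|u0]; first by rewrite e eqxx in fu.
move: uz; rewrite H // => un; apply/mapP; exists `|u|%N; last by lia.
by rewrite mem_iota; lia.
Qed.

Lemma Delta_inv_lt0 (R : realType) (f : int -> R) z :
  (forall u, u < 0 -> f u = 0) -> z < 0 -> Delta_inv f z = 0.
Proof. by move=> f0 z0; rewrite (@Delta_inv_nat _ _ 0) ?big_ord0 // => u; lia. Qed.

Lemma Delta_inv_diff (R : realType) (f : int -> R) z :
  (forall u, u < 0 -> f u = 0) -> Delta_inv f z = Delta_inv f (z - 1) + f z.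
Proof.
move=> f0; case: z => n; last by rewrite !Delta_inv_lt0 ?f0 ?addr0 //; lia.
have H1 (u : int) : 0 <= u -> (u <= n%:Z) = (u < n.+1%:Z) by lia.
have H2 (u : int) : 0 <= u -> (u <= n%:Z - 1) = (u < n%:Z) by lia.
rewrite (Delta_inv_nat f0 H1) (Delta_inv_nat f0 H2).
by rewrite big_ord_recr.
Qed.

Lemma eq_of_diff (R : zmodType) (F G : int -> R) :
  (forall z, z < 0 -> F z = G z) ->
  (forall z, F z - F (z - 1) = G z - G (z - 1)) -> F =1 G.
Proof.
move=> H0 H; case=> n; last by apply: H0; lia.
elim: n => [|n IH].
  by have := H 0; rewrite (H0 (0 - 1)) // => /addIr.
have := H n.+1; have -> : n.+1%:Z - 1 = n by lia.
by rewrite IH => /addIr.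
Qed.

Lemma Delta_inv_phi_iterS (R : realType) t z :
  Delta_inv (phi_iter R t.+1) z =
  2^-1 * (Delta_inv (phi_iter R t) z + Delta_inv (phi_iter R t) (z - 1)).
Proof.
have p0 s u : u < 0 -> phi_iter R s u = 0 by exact: phi_iter_lt0.
move: z; apply: eq_of_diff => z.
  by move=> z0; rewrite !Delta_inv_lt0 ?addr0 ?mulr0 //; [exact: p0|lia|exact: p0|exact: p0].
rewrite (Delta_inv_diff z (p0 t.+1)) (Delta_inv_diff z (p0 t)).
by rewrite (Delta_inv_diff (z - 1) (p0 t)) phi_iterS; ring.
Qed.

Lemma Delta_inv_delta (R : realType) z : Delta_inv (delta R 0) z = (0 <= z)%R%:R.
Proof.
have d0 u : u < 0 -> delta R 0 u = 0 by move=> u0; rewrite /delta lt_eqF.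
move: z; apply: eq_of_diff => z; first by move=> z0; rewrite Delta_inv_lt0 // leNgt z0.
rewrite Delta_inv_diff // [X in X - _]addrC addrK /delta.
have -> : (0 <= z) = (z == 0) || (0 <= z - 1) by lia.
have : ~~ ((z == 0) && (0 <= z - 1)) by lia.
by case: (z == 0); case: (0 <= z - 1) => //= _; ring.
Qed.

(** * Rows of the kernel determinant: backward equation and boundary conditions *)

Definition x_row (R : realType) k t (x' : 'rV[int]_k.+1) (y' : 'rV[int]_k)
    (i : 'I_k.+1) (u : int) : 'rV[R]_(k.+1 + k) :=
  row_mx (\row_j phi_iter R t (x' ord0 j - u))
    (\row_j (Delta_inv (phi_iter R t) (y' ord0 j - u) - (i <= j)%N%:R)).

Definition y_row (R : realType) k t (x' : 'rV[int]_k.+1) (y' : 'rV[int]_k)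
    (u : int) : 'rV[R]_(k.+1 + k) :=
  row_mx (\row_j Delta (phi_iter R t) (x' ord0 j - u))
    (\row_j phi_iter R t (y' ord0 j - u)).

Definition xy_row (R : realType) k t (x : 'rV[int]_k.+1) (y : 'rV[int]_k)
    (x' : 'rV[int]_k.+1) (y' : 'rV[int]_k) (l : 'I_(k.+1 + k)) (c : int) :=
  match fintype.split l with
  | inl i => x_row R t x' y' i (x ord0 i + c)
  | inr i => y_row R t x' y' (y ord0 i + c)
  end.

Lemma q_kernel_rows (R : realType) k t (x : 'rV[int]_k.+1) (y : 'rV[int]_k) x' y' :
  q_kernel R t x y x' y' =
  \det (col_mx (\matrix_i x_row R t x' y' i (x ord0 i)) (\matrix_i y_row R t x' y' (y ord0 i))).
Proof.
congr (\det _); apply/matrixP => a b; rewrite /block_mx.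
case: (split_ordP a) => i ->; case: (split_ordP b) => j ->.
- by rewrite !col_mxEu row_mxEl [RHS]mxE /x_row row_mxEl !mxE.
- by rewrite !col_mxEu row_mxEr [RHS]mxE /x_row row_mxEr !mxE.
- by rewrite !col_mxEd row_mxEl [RHS]mxE /y_row row_mxEl !mxE.
- by rewrite !col_mxEd row_mxEr [RHS]mxE /y_row row_mxEr !mxE.
Qed.

(** [Delta] inverts [Delta_inv], and the indicator depends on [i] but not on [u], so it cancels.
    This identity is the source of the reflecting boundary condition. *)
Lemma x_row_diff (R : realType) k t x' y' (i : 'I_k.+1) u :
  x_row R t x' y' i u = x_row R t x' y' i (u + 1) + y_row R t x' y' u.
Proof.
rewrite /x_row /y_row add_row_mx; congr (row_mx _ _); apply/rowP => j; rewrite !mxE /Delta.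
  by rewrite opprD (addrA (x' _ j)); ring.
rewrite (Delta_inv_diff (y' _ j - u)); last by move=> v; exact: phi_iter_lt0.
by rewrite opprD (addrA (y' _ j)); ring.
Qed.

Lemma x_rowS (R : realType) k t x' y' (i : 'I_k.+1) u :
  x_row R t.+1 x' y' i u = 2^-1 *: (x_row R t x' y' i (u + 1) + x_row R t x' y' i (u + 0)).
Proof.
rewrite /x_row add_row_mx scale_row_mx; congr (row_mx _ _); apply/rowP => j;
  rewrite !mxE opprD ?(addrA (x' _ j)) ?(addrA (y' _ j)) !addr0.
  by rewrite phi_iterS addrC.
by rewrite Delta_inv_phi_iterS; field.
Qed.

Lemma y_rowS (R : realType) k t (x' : 'rV[int]_k.+1) y' u :
  y_row R t.+1 x' y' u = 2^-1 *: (y_row R t x' y' (u + 1) + y_row R t x' y' (u + 0)).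
Proof.
rewrite /y_row add_row_mx scale_row_mx; congr (row_mx _ _); apply/rowP => j;
  rewrite !mxE opprD ?(addrA (x' _ j)) ?(addrA (y' _ j)) !addr0.
  by rewrite /Delta !phi_iterS; ring.
by rewrite phi_iterS addrC.
Qed.

Lemma det_sum_rows (R : comPzRingType) n (J : finType) (F : 'I_n -> J -> 'rV[R]_n) :
  \det (\matrix_i \sum_c F i c) = \sum_(g : {ffun 'I_n -> J}) \det (\matrix_i F i (g i)).
Proof.
rewrite /determinant exchange_big; apply: eq_bigr => s _; rewrite -mulr_sumr.
congr (_ * _); transitivity (\prod_i \sum_c F i c ord0 (s i)).
  by apply: eq_bigr => i _; rewrite mxE summxE.
rewrite bigA_distr_bigA; apply: eq_bigr => g _.
by apply: eq_bigr => i _; rewrite mxE.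
Qed.

Lemma xy_row_jump (R : realType) k t (x : 'rV[int]_k.+1) (y : 'rV[int]_k) x' y'
    (b : {ffun 'I_k.+1 -> bool}) (g : {ffun 'I_k -> bool}) (h : {ffun 'I_(k.+1 + k) -> bool}) :
  (forall i, h (lshift k i) = b i) -> (forall i, h (rshift k.+1 i) = g i) ->
  \det (\matrix_l xy_row R t x y x' y' l (h l)%:R) =
  q_kernel R t (jump x b) (jump y g) x' y'.
Proof.
move=> hb hg; rewrite q_kernel_rows; congr (\det _); apply/row_matrixP => l.
case: (split_ordP l) => i ->; rewrite rowK /xy_row.
  by rewrite (unsplitK (inl _ i)) rowKu rowK hb mxE.
by rewrite (unsplitK (inr _ i)) rowKd rowK hg mxE.
Qed.

(** Each row at time [t.+1] is the average of two rows at time [t], one per coin outcome;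
    multilinearity of the determinant gives the sum over coin vectors. *)
Lemma q_kernelS (R : realType) k t (x : 'rV[int]_k.+1) (y : 'rV[int]_k) x' y' :
  q_kernel R t.+1 x y x' y' = 2 ^- (k + k.+1) *
    \sum_(g : {ffun 'I_k -> bool}) \sum_(b : {ffun 'I_k.+1 -> bool})
      q_kernel R t (jump x b) (jump y g) x' y'.
Proof.
have -> : q_kernel R t.+1 x y x' y' =
    \det (2^-1 *: \matrix_l \sum_(c : bool) xy_row R t x y x' y' l c%:R).
  rewrite q_kernel_rows; congr (\det _); apply/row_matrixP => l.
  rewrite linearZ /= rowK big_bool /xy_row.
  case: (split_ordP l) => i ->; rewrite ?rowKu ?rowKd rowK; [exact: x_rowS|exact: y_rowS].
rewrite detZ exprVn det_sum_rows (addnC k k.+1); congr (_ * _); rewrite [RHS]pair_bigA /=.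
pose join (gb : {ffun 'I_k -> bool} * {ffun 'I_k.+1 -> bool}) : {ffun 'I_(k.+1 + k) -> bool} :=
  [ffun l => match fintype.split l with inl i => gb.2 i | inr i => gb.1 i end].
have joinl gb i : join gb (lshift k i) = gb.2 i by rewrite ffunE (unsplitK (inl _ i)).
have joinr gb i : join gb (rshift k.+1 i) = gb.1 i by rewrite ffunE (unsplitK (inr _ i)).
pose unjoin (h : {ffun 'I_(k.+1 + k) -> bool}) : {ffun 'I_k -> bool} * {ffun 'I_k.+1 -> bool} :=
  ([ffun i => h (rshift k.+1 i)], [ffun i => h (lshift k i)]).
rewrite (reindex join) /=; last first.
  exists unjoin => [[g b] _|h _].
    by congr (_, _); apply/ffunP => i; rewrite ffunE ?joinl ?joinr.
  by apply/ffunP => l; case: (split_ordP l) => i ->; rewrite ?joinl ?joinr ffunE.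
by apply: eq_bigr => -[g b] _; apply: xy_row_jump => i; rewrite ?joinl ?joinr.
Qed.

(** Since jumps are at most one, a failure of strictness makes two coordinates coincide, and the
    determinant has two equal rows. *)
Lemma q_kernel_collision (R : realType) k t (z : 'rV[int]_k.+1) (y : 'rV[int]_k) g x' y' :
  strict y -> ~~ strict (jump y g) -> q_kernel R t z (jump y g) x' y' = 0.
Proof.
move=> /strictP sy; rewrite /strict negb_forall => /existsP[i].
rewrite negb_forall => /existsP[j]; rewrite negb_imply => /andP[ij].
rewrite -leNgt => le_ji.
have eq_ij : jump y g ord0 i = jump y g ord0 j.
  have := sy _ _ ij; move: le_ji; rewrite !mxE; case: (g i); case: (g j) => /=; lia.
rewrite q_kernel_rows; apply: (@determinant_alternate _ _ _ (rshift k.+1 i) (rshift k.+1 j)).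
  by rewrite (inj_eq (@rshift_inj _ _)) -val_eqE /= ltn_eqF.
by move=> l; rewrite !col_mxEd [LHS]mxE [RHS]mxE eq_ij.
Qed.

(** Moving a coordinate of [z] off a wall changes its row by plus or minus the row of that wall, a
    row operation of determinant 1. *)
Lemma q_kernel_pushed (R : realType) k t (z : 'rV[int]_k.+1) (y : 'rV[int]_k) x' y' :
  strict y -> q_kernel R t (pushed z y) y x' y' = q_kernel R t z y x' y'.
Proof.
move=> /strictP sy; rewrite !q_kernel_rows.
(* Blocking moves a coordinate from [y_j + 1] down to [y_j] and adds row [y_j]; pushing moves it
   from [y_j] up to [y_j + 1] and subtracts that row. *)
pose S : 'M[R]_(k.+1, k) := \matrix_(i, j)
  (((unlift ord_max i == Some j) && (z ord0 i == y ord0 j + 1))%:R -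
   ((unlift ord0 i == Some j) && (z ord0 i == y ord0 j))%:R).
set X := \matrix_i _; set Y := \matrix_i _; set X0 := \matrix_i _.
have pickR (o : option 'I_k) (p : pred 'I_k) (f : 'I_k -> 'rV[R]_(k.+1 + k)) :
    \sum_j ((o == Some j) && p j)%:R *: f j =
    oapp (fun j => (p j)%:R *: f j) 0 o.
  case: o => [j|] /=; last by rewrite big1 // => j _; rewrite scale0r.
  rewrite (bigD1 j) //= eqxx big1 ?addr0 // => i ij.
  by rewrite (_ : (Some j == Some i) = false) ?scale0r //; apply/eqP => -[e]; rewrite e eqxx in ij.
have XE : X = X0 + S *m Y.
  apply/row_matrixP => i; rewrite linearD /= row_mul mulmx_sum_row !rowK.
  rewrite (eq_bigr (fun j =>
    ((unlift ord_max i == Some j) && (z ord0 i == y ord0 j + 1))%:R *: y_row R t x' y' (y ord0 j) -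
    ((unlift ord0 i == Some j) && (z ord0 i == y ord0 j))%:R *: y_row R t x' y' (y ord0 j)));
    last first.
    by move=> j _; rewrite rowK !mxE scalerBl.
  rewrite sumrB !pickR mxE /push1.
  have right u (e : z ord0 i = u + 1) :
      x_row R t x' y' i u = x_row R t x' y' i (z ord0 i) + y_row R t x' y' u.
    by rewrite e x_row_diff.
  case: (right_wallP i) => [j e1 e1'|e1]; case: (left_wallP i) => [j' e2 e2'|e2] /=.
  - have /sy lt_j : (j' < j)%N by lia.
    case: eqP => [h1|_]; case: eqP => [h2|_] /=; rewrite ?mulr0n ?mulr1n.
    + by exfalso; move: lt_j h1; rewrite h2; clear; lia.
    + rewrite (_ : _ + _ = y ord0 j); last by rewrite h1; clear; lia.
      by rewrite scale1r scale0r subr0 (right _ h1).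
    + rewrite (_ : _ + _ = z ord0 i + 1); last by clear; lia.
      by rewrite scale0r scale1r sub0r -h2 [in RHS]x_row_diff addrK.
    + rewrite (_ : _ + _ = z ord0 i); last by clear; lia.
      by rewrite !scale0r subr0 addr0.
  - case: eqP => [h1|_] /=.
    + rewrite (_ : _ + _ = y ord0 j); last by rewrite h1; clear; lia.
      by rewrite scale1r subr0 (right _ h1).
    + rewrite (_ : _ + _ = z ord0 i); last by clear; lia.
      by rewrite scale0r subr0 addr0.
  - case: eqP => [h2|_] /=.
    + rewrite (_ : _ + _ = z ord0 i + 1); last by clear; lia.
      by rewrite scale1r sub0r -h2 [in RHS]x_row_diff addrK.
    + rewrite (_ : _ + _ = z ord0 i); last by clear; lia.
      by rewrite scale0r subr0 addr0.
  - rewrite (_ : _ + _ = z ord0 i); last by clear; lia.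
    by rewrite subr0 addr0.
have -> : col_mx X Y = block_mx 1%:M S 0 1%:M *m col_mx X0 Y.
  by rewrite mul_block_col !mul1mx mul0mx add0r XE.
by rewrite det_mulmx det_ublock !det1 !mul1r.
Qed.

Lemma strict_le k (y : 'rV[int]_k) (i j : 'I_k) :
  strict y -> (i <= j)%N -> y ord0 i <= y ord0 j.
Proof.
move=> /strictP sy; rewrite leq_eqVlt => /predU1P[/val_inj->//|/sy/ltW//].
Qed.

Lemma interl_le n (x : 'rV[int]_n.+1) (y : 'rV[int]_n) (i : 'I_n.+1) (j : 'I_n) :
  interl x y -> (i <= j)%N -> x ord0 i <= y ord0 j.
Proof.
move=> xy ij; have /interlP/(_ j)/andP[h _] := xy.
apply: le_trans h; apply: strict_le; first exact: interl_strict_top xy.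
by rewrite /= /bump; have := ltn_ord j; lia.
Qed.

Lemma interl_lt n (x : 'rV[int]_n.+1) (y : 'rV[int]_n) (i : 'I_n.+1) (j : 'I_n) :
  interl x y -> (j < i)%N -> y ord0 j < x ord0 i.
Proof.
move=> xy ij; have /interlP/(_ j)/andP[_ h] := xy.
by apply: (lt_le_trans h); apply: strict_le; first exact: interl_strict_top xy.
Qed.

Lemma det_zero_row (R : comPzRingType) n (A : 'M[R]_n) i :
  (forall j, A i j = 0) -> \det A = 0.
Proof. by move=> H; rewrite (expand_det_row _ i) big1 // => j _; rewrite H mul0r. Qed.

Lemma det_zero_col (R : comPzRingType) n (A : 'M[R]_n) j :
  (forall i, A i j = 0) -> \det A = 0.
Proof. by move=> H; rewrite -det_tr (@det_zero_row _ _ _ j) // => i; rewrite mxE. Qed.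

Lemma det_opposite_cols (R : comPzRingType) n (A : 'M[R]_n) j1 j2 :
  j1 != j2 -> (forall i, A i j1 = - A i j2) -> \det A = 0.
Proof.
move=> ne H; pose v : 'rV[R]_n := \row_j (if j == j2 then -1 else 1).
have -> : A = (\matrix_(i, j) (if j == j2 then - A i j else A i j)) *m diag_mx v.
  apply/matrixP => i j; rewrite mul_mx_diag !mxE; case: ifP => _; first by rewrite mulrNN mulr1.
  by rewrite mulr1.
rewrite det_mulmx -det_tr (@determinant_alternate _ _ _ j1 j2) ?mul0r // => i.
by rewrite !mxE eqxx (negbTE ne).
Qed.

(* At the first place where [x_1, y_1, x_2, y_2, ...] and
   [x'_1, y'_1, x'_2, y'_2, ...] differ, the row of the smaller unprimed entry,
   or the column of the smaller primed entry, vanishes or is, up to sign, equal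
   to the row or column of the preceding entry. *)
Lemma q_kernel0 (R : realType) k (x : 'rV[int]_k.+1) (y : 'rV[int]_k) x' y' :
  interl x y -> interl x' y' ->
  q_kernel R 0 x y x' y' = ((x == x') && (y == y'))%:R.
Proof.
move=> xy xy'; have sx := interl_strict_top xy; have sx' := interl_strict_top xy'.
have sy := interl_strict xy; have sy' := interl_strict xy'.
have le_xy i j := interl_le (i := i) (j := j) xy.
have lt_yx i j := interl_lt (i := i) (j := j) xy.
have le_xy' i j := interl_le (i := i) (j := j) xy'.
have lt_yx' i j := interl_lt (i := i) (j := j) xy'.
have le_x i j := strict_le (i := i) (j := j) sx.
have le_x' i j := strict_le (i := i) (j := j) sx'.
have le_y i j := strict_le (i := i) (j := j) sy.
have le_y' i j := strict_le (i := i) (j := j) sy'.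
move/strictP: sx => lt_x; move/strictP: sx' => lt_x'.
move/strictP: sy => lt_y; move/strictP: sy' => lt_y'.
pose M := block_mx (\matrix_(i < k.+1, j < k.+1) ((x' ord0 j == x ord0 i)%:R : R))
  (\matrix_(i < k.+1, j < k) ((x ord0 i <= y' ord0 j)%R%:R - (i <= j)%N%:R))
  (\matrix_(i < k, j < k.+1) ((x' ord0 j == y ord0 i)%:R - (x' ord0 j == y ord0 i + 1)%:R))
  (\matrix_(i < k, j < k) (y' ord0 j == y ord0 i)%:R).
have -> : q_kernel R 0 x y x' y' = \det M.
  rewrite /q_kernel /phi_iter /Delta /delta; congr (\det (block_mx _ _ _ _));
    apply/matrixP => i j; rewrite !mxE ?Delta_inv_delta ?subr_eq0 ?subr_ge0 //.
  by rewrite subr_eq [1 + _]addrC.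
have [/andP[/eqP e1 /eqP e2]|ne] := boolP ((x == x') && (y == y')).
  rewrite /M -e1 -e2.
  have -> : \matrix_(i < k.+1, j < k.+1) ((x ord0 j == x ord0 i)%:R : R) = 1%:M.
    apply/matrixP => i j; rewrite !mxE; have [->|ij] := eqVneq i j; first by rewrite eqxx.
    case: (ltngtP i j) => [/lt_x h|/lt_x h|/val_inj e]; last by rewrite e eqxx in ij.
      by rewrite gt_eqF.
    by rewrite lt_eqF.
  have -> : \matrix_(i < k, j < k) ((y ord0 j == y ord0 i)%:R : R) = 1%:M.
    apply/matrixP => i j; rewrite !mxE; have [->|ij] := eqVneq i j; first by rewrite eqxx.
    case: (ltngtP i j) => [/lt_y h|/lt_y h|/val_inj e]; last by rewrite e eqxx in ij.
      by rewrite gt_eqF.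
    by rewrite lt_eqF.
  (* By interlacing, [x_i <= y_j] if and only if [i <= j], so this block vanishes. *)
  have -> : \matrix_(i < k.+1, j < k) ((x ord0 i <= y ord0 j)%R%:R - (i <= j)%N%:R : R) = 0.
    apply/matrixP => i j; rewrite !mxE; case: (leqP i j) => [/le_xy ->|/lt_yx h].
      by rewrite subrr.
    by rewrite leNgt h subrr.
  by rewrite det_lblock !det1 mulr1.
pose differ (i : 'I_k.+1) := (x ord0 i != x' ord0 i) ||
  oapp (fun j => y ord0 j != y' ord0 j) false (unlift ord_max i).
have [i0 Pi0] : exists i, differ i.
  move: ne; rewrite negb_and => /orP[] /eqP ne.
    have [i h|same] := pickP (fun i => x ord0 i != x' ord0 i).
      by exists i; rewrite /differ h.
    by case: ne; apply: row_ext => i; apply/eqP; have := same i; case: eqP.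
  have [i h|same] := pickP (fun i => y ord0 i != y' ord0 i).
    by exists (lift ord_max i); rewrite /differ liftK /= h orbT.
  by case: ne; apply: row_ext => i; apply/eqP; have := same i; case: eqP.
case: (arg_minnP (fun i : 'I_k.+1 => i : nat) Pi0) => i Pi min_i.
have same_x (a : 'I_k.+1) : (a < i)%N -> x ord0 a = x' ord0 a.
  by move=> ai; apply/eqP; apply: contraTT ai => h; rewrite -leqNgt min_i // /differ h.
have same_y (b : 'I_k) : (b < i)%N -> y ord0 b = y' ord0 b.
  move=> bi; apply/eqP; apply: contraTT bi => h; rewrite -leqNgt.
  by rewrite -(lift_max b) min_i // /differ liftK /= h orbT.
have [lt|gt|eq_x] := ltgtP (x ord0 i) (x' ord0 i).
- apply: (det_zero_row (i := lshift k i)) => l; rewrite /M.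
  case: (split_ordP l) => b ->; rewrite ?block_mxEul ?block_mxEur mxE.
    case: (ltnP b i) => bi; first by rewrite -same_x // lt_eqF // lt_x.
    by rewrite gt_eqF // (lt_le_trans lt) // le_x'.
  case: (leqP i b) => bi.
    by rewrite (le_trans (ltW lt)) ?le_xy' // subrr.
  by rewrite -same_y // leNgt lt_yx // subrr.
- have col_x (a : 'I_k.+1) : (x' ord0 i == x ord0 a) = false.
    case: (ltnP a i) => ai; first by rewrite same_x // gt_eqF // lt_x'.
    by rewrite lt_eqF // (lt_le_trans gt) // le_x.
  have col_y (a : 'I_k) : (x' ord0 i == y ord0 a) = false.
    case: (ltnP a i) => ai; first by rewrite same_y // gt_eqF // lt_yx'.
    by rewrite lt_eqF // (lt_le_trans gt) // le_xy.
  (* If [x'_i = y_j + 1] for some [j < i], the column of [x'_i] is minus that of [y'_j = y_j];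
     otherwise it is zero. *)
  have [j /andP[lt_ji /eqP ej]|no] := pickP
      (fun j : 'I_k => (j < i)%N && (x' ord0 i == y ord0 j + 1)).
    apply: (det_opposite_cols (j1 := lshift k i) (j2 := rshift k.+1 j)).
      by rewrite eq_lrshift.
    move=> l; rewrite /M; case: (split_ordP l) => a ->.
      rewrite block_mxEul block_mxEur !mxE col_x -same_y //.
      case: (leqP a j) => [/le_xy ->|/lt_yx h]; first by rewrite subrr oppr0.
      by rewrite leNgt h subrr oppr0.
    by rewrite block_mxEdl block_mxEdr !mxE col_y sub0r ej (inj_eq (addIr _)) -same_y.
  apply: (det_zero_col (j := lshift k i)) => l; rewrite /M.
  case: (split_ordP l) => a ->; rewrite ?block_mxEul ?block_mxEdl mxE.
    by rewrite col_x.
  rewrite col_y sub0r; have := no a; case: (ltnP a i) => /= ai; first by move=> ->; rewrite oppr0.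
  have := le_xy _ _ ai; move: gt; clear => h1 h2 _.
  by rewrite (_ : (_ == _) = false) ?oppr0 //; lia.
move: Pi; rewrite /differ eq_x eqxx /=; case: right_wallP => [j _ ij|//] /= ne_y.
have [lt|gt|eq_y] := ltgtP (y ord0 j) (y' ord0 j); last by rewrite eq_y eqxx in ne_y.
- have row_y (b : 'I_k) : (y' ord0 b == y ord0 j) = false.
    case: (ltnP b j) => bj; first by rewrite -same_y ?ij // lt_eqF // lt_y.
    by rewrite gt_eqF // (lt_le_trans lt) // le_y'.
  have row_x1 (b : 'I_k.+1) : (x' ord0 b == y ord0 j + 1) = false.
    case: (leqP b i) => bi.
      have := le_x' _ _ bi; have : x ord0 i <= y ord0 j by rewrite le_xy // ij.
      by rewrite eq_x; clear; lia.
    by have := lt_yx' b j; rewrite -ij => /(_ bi); move: lt; clear; lia.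
  (* If [x_i = y_j], the row of [y_j] repeats that of [x_i]; otherwise it is zero. *)
  have [eq_xy|ne_xy] := eqVneq (x ord0 i) (y ord0 j).
    apply: (@determinant_alternate _ _ _ (lshift k i) (rshift k.+1 j)).
      by rewrite eq_lrshift.
    move=> l; rewrite /M; case: (split_ordP l) => b ->.
      by rewrite block_mxEul block_mxEdl !mxE row_x1 subr0 eq_xy.
    rewrite block_mxEur block_mxEdr !mxE row_y.
    case: (leqP i b) => bi; first by rewrite eq_x le_xy' // subrr.
    by rewrite -same_y // leNgt lt_yx // subrr.
  apply: (det_zero_row (i := rshift k.+1 j)) => l; rewrite /M.
  case: (split_ordP l) => b ->; rewrite ?block_mxEdl ?block_mxEdr mxE ?row_y //.
  rewrite row_x1 subr0; case: (ltngtP b i) => bi.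
  - rewrite -same_x // lt_eqF // (lt_le_trans (lt_x _ _ bi)) // le_xy //.
    by rewrite ij.
  - by rewrite gt_eqF // (lt_trans lt) // lt_yx' // -ij.
  - by rewrite (val_inj bi) -eq_x (negbTE ne_xy).
- apply: (det_zero_col (j := rshift k.+1 j)) => l; rewrite /M.
  case: (split_ordP l) => a ->; rewrite ?block_mxEur ?block_mxEdr mxE.
    case: (leqP a j) => aj.
      have -> : x ord0 a = x' ord0 a.
        by case: (ltngtP a i) => [/same_x//||/val_inj->//]; rewrite ij ltnNge aj.
      by rewrite le_xy' // subrr.
    by rewrite leNgt (lt_trans gt) ?lt_yx // subrr.
  case: (ltnP a j) => aj; first by rewrite same_y ?ij // gt_eqF // lt_y'.
  by rewrite lt_eqF // (lt_le_trans gt) // le_y.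
Qed.

(** * Transitions of the pair *)

Definition at_pair k (x : 'rV[int]_k.+1) (y : 'rV[int]_k) (z : pattern k.+1) : bool :=
  (z.2 == x) && (top z.1 == y).

Lemma gt_sum_at_pair (R : numFieldType) k (x x' : 'rV[int]_k.+1) (y y' : 'rV[int]_k)
    (F : pattern k.+1 -> R) :
  gt_sum y (fun z => (at_pair x' y' (z, x))%:R * F (z, x)) =
  ((x == x') && (y == y'))%:R * gt_sum y' (fun z => F (z, x')).
Proof.
rewrite (@eq_gt_sum _ _ _ _ (fun z => ((x == x') && (y == y'))%:R * F (z, x))).
  by rewrite gt_sumZ; case: andP => [[/eqP-> /eqP->]|]; rewrite ?mul0r.
by move=> z <-.
Qed.

(** Both sides satisfy the same backward equation: colliding jumps contribute 0 to the kernel, and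
    pushing the upper row leaves the kernel unchanged. They agree at time 0 by [q_kernel0]. *)
Lemma gt_sum_transition (R : realType) k t (x : 'rV[int]_k.+1) (y : 'rV[int]_k) x' y' :
  interl x y -> interl x' y' ->
  gt_sum y (fun z => iter t (@evolve R k.+1) (fun z => (at_pair x' y' z)%:R) (z, x)) =
  q_kernel R t x y x' y' * gt_count R y'.
Proof.
move=> xy xy'; elim: t x y xy => [|t IH] x y xy.
  rewrite q_kernel0 // -gt_sum1 ?(interl_strict xy') // -(gt_sum_at_pair x x' y y' (fun=> 1)) /=.
  by apply: eq_gt_sum => z _; rewrite mulr1.
rewrite /= gt_sum_evolve_pair ?(interl_strict xy) // q_kernelS -mulrA; congr (_ * _).
rewrite [RHS]mulr_suml big_mkcond; apply: eq_bigr => g _; rewrite mulr_suml.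
case: ifPn => sg; last first.
  by rewrite big1 // => b _; rewrite q_kernel_collision ?mul0r ?(interl_strict xy).
apply: eq_bigr => b _; rewrite IH; last exact: pushed_interl.
by rewrite (q_kernel_pushed _ _ _ _ _ sg).
Qed.

(* Given a visit to [(x, y)] at time [s], the pattern below [y] is uniform: the
   dependence on [F] factors out, which is stated without division. *)
Lemma gt_sum_visit (R : numFieldType) k s (x0 x : 'rV[int]_k.+1) (y0 y : 'rV[int]_k)
    (F : pattern k.+1 -> R) : interl x0 y0 ->
  gt_sum y0 (fun z => iter s (@evolve R k.+1) (fun z => (at_pair x y z)%:R * F z) (z, x0))
    * gt_sum y (fun=> 1) =
  gt_sum y0 (fun z => iter s (@evolve R k.+1) (fun z => (at_pair x y z)%:R * 1) (z, x0))
    * gt_sum y (fun z => F (z, x)).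
Proof.
elim: s x0 y0 => [|s IH] x0 y0 xy0 /=.
  rewrite gt_sum_at_pair (gt_sum_at_pair _ _ _ _ (fun=> 1)); exact: mulrAC.
rewrite !gt_sum_evolve_pair ?(interl_strict xy0) // -!mulrA; congr (_ * _).
rewrite !mulr_suml; apply: eq_bigr => g sg; rewrite !mulr_suml; apply: eq_bigr => b _.
by apply: IH; apply: pushed_interl.
Qed.

(** * Sums over coin sequences *)

Fixpoint words (C : finType) (n : nat) : seq (seq C) :=
  if n is n'.+1 then [seq c :: l | c <- index_enum C, l <- words C n'] else [:: [::]].

Lemma mem_words (C : finType) n (l : seq C) : (l \in words C n) = (size l == n).
Proof.
elim: n l => [|n IH] l; first by rewrite inE; case: l.
apply/allpairsP/idP => [[[c l'] /= [_ l'n ->]]|]; first by rewrite /= eqSS -IH.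
case: l => [|c l] //= ln; exists (c, l); split => //=; first exact: mem_index_enum.
by rewrite IH.
Qed.

Lemma words_uniq (C : finType) n : uniq (words C n).
Proof.
elim: n => [|n IH] //=; apply: allpairs_uniq => //; first exact: index_enum_uniq.
by move=> [c l] [c' l'] _ _ /= [-> ->].
Qed.

Lemma evolve1 (R : numFieldType) k t (z : pattern k) :
  inhabited (coin_table k) -> iter t (@evolve R k) (fun=> 1) z = 1.
Proof.
move=> [c0]; elim: t z => [|t IH] z //=; rewrite /evolve /mean.
rewrite (eq_bigr (fun=> 1)) // sumr_const mulVf // pnatr_eq0 -lt0n.
by apply/card_gt0P; exists c0.
Qed.

(** Iterated means unfold into one sum over coin words. The first letter drives the first step, so
    the prefix of length [s] gives the pattern seen by [G]. *)
Lemma sum_words (R : numFieldType) k s t (F G : pattern k -> R) (z : pattern k) :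
  inhabited (coin_table k) ->
  \sum_(l <- words (coin_table k) (s + t))
     G (foldl (@step k) z (take s l)) * F (foldl (@step k) z l) =
  #|coin_table k|%:R ^+ (s + t) *
    iter s (@evolve R k) (fun u => G u * iter t (@evolve R k) F u) z.
Proof.
move=> [c0]; have C0 : (#|coin_table k|%:R : R) != 0.
  by rewrite pnatr_eq0 -lt0n; apply/card_gt0P; exists c0.
have one (f : pattern k -> R) u :
    \sum_(c : coin_table k) f (step u c) = #|coin_table k|%:R * evolve f u.
  by rewrite /evolve /mean mulVKf.
elim: s z => [|s IH] z.
  rewrite add0n /= (eq_bigr (fun l => G z * F (foldl (@step k) z l))); last first.
    by move=> l _; rewrite take0.
  rewrite -mulr_sumr mulrCA; congr (_ * _); elim: t z => [|t IH] z.
    by rewrite /= big_seq1 expr0 mul1r.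
  rewrite /= big_allpairs_dep /= (eq_bigr _ (fun c _ => IH (step z c))).
  by rewrite -mulr_sumr one exprSr mulrA.
rewrite addSn [words _ _]/= big_allpairs_dep /= (eq_bigr _ (fun c _ => IH (step z c))).
by rewrite -mulr_sumr one exprSr mulrA.
Qed.

(** * The particle process as a walk on patterns *)

Fixpoint pattern_of k (f : nat -> nat -> int) : pattern k :=
  if k is k'.+1 then (pattern_of k' f, \row_(i < k'.+1) f k'.+1 i.+1) else tt.

Fixpoint coins_of k (f : nat -> nat -> nat) : coin_table k :=
  if k is k'.+1 then (coins_of k' f, [ffun i : 'I_k'.+1 => f k'.+1 i.+1 == 1%N]) else tt.

Fixpoint bit k : coin_table k -> nat -> nat -> bool :=
  if k is k'.+1 then fun c j i => if j == k'.+1 then c.2 (inord i.-1) else bit c.1 j i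
  else fun _ _ _ => false.

Lemma top_pattern_of k f : top (pattern_of k f) = \row_(i < k) f k i.+1.
Proof. by case: k => // ; apply/rowP => -[]. Qed.

Lemma eq_pattern_of k f f' :
  (forall j i, (1 <= i <= j)%N -> (j <= k)%N -> f j i = f' j i) ->
  pattern_of k f = pattern_of k f'.
Proof.
elim: k => [|k IH] H //=; congr (_, _); first by apply: IH => j i ij jk; apply: H => //; lia.
by apply/rowP => i; rewrite !mxE H //=; have := ltn_ord i; lia.
Qed.

Lemma coins_of_bit k (c : coin_table k) (f : nat -> nat -> nat) :
  (forall j i, (1 <= i <= j)%N -> (j <= k)%N -> f j i = bit c j i) ->
  coins_of k f = c.
Proof.
elim: k c => [|k IH] [] //= c b H; congr (_, _).
  apply: IH => j i ij jk; rewrite H //; last by lia.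
  by rewrite ifF //; apply/eqP; lia.
apply/ffunP => i; rewrite ffunE H //; last by have := ltn_ord i; lia.
by rewrite eqxx inord_val; case: (b i).
Qed.

Lemma bit_coins_of k (f : nat -> nat -> nat) j i :
  (1 <= i <= j)%N -> (j <= k)%N -> bit (coins_of k f) j i = (f j i == 1%N).
Proof.
elim: k => [|k IH] ij jk /=; first by lia.
case: eqP => [e|ne]; last by apply: IH => //; lia.
by rewrite ffunE e inordK; [rewrite prednK //; lia|lia].
Qed.

(** The rules of the dynamics are the cases of [push1] with both, one or no wall present, the walls
    being the updated positions of the line below. *)
Lemma pattern_of_step m (b : nat -> nat -> nat -> nat) (X : nat -> nat -> nat -> int) k t :
  aztec_dynamics m b X -> (k <= m)%N ->
  (forall j i, (1 <= i <= j)%N -> (j <= k)%N -> (b j i t.+1 <= 1)%N) ->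
  pattern_of k (fun j i => X j i t.+1) =
  step (pattern_of k (fun j i => X j i t)) (coins_of k (fun j i => b j i t.+1)).
Proof.
move=> dyn; elim: k => [//|k IH] km b01 /=.
have {}IH := IH (ltnW km) (fun j i ij jk => b01 j i ij (leqW jk)).
rewrite -IH; congr (_, _); apply/rowP => i; rewrite !mxE ffunE top_pattern_of /push1.
(* A coin is stored as the truth value of being 1, which recovers its value because it is at most
   1. *)
have -> : (b k.+1 i.+1 t.+1 == 1%N)%:R = (b k.+1 i.+1 t.+1)%:Z :> int.
  have := b01 k.+1 i.+1; have := ltn_ord i.
  case: (b _ _ _) => [|[|n]] //= h1 h2; suff : (n.+2 <= 1)%N by []; apply: h2; lia.
case: dyn => _ d1 dL dR dM; have := ltn_ord i.
case: (right_wallP i) => [j _ e1|e1]; case: (left_wallP i) => [j' _ e2|e2] /= _; rewrite ?mxE.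
- have ltj := ltn_ord j; rewrite (dM k.+1 i.+1) /=; [|lia|lia].
  by rewrite -e1 -e2.
- rewrite -e1 e2 (dL k.+1) /= ?addr0 //.
  by have := ltn_ord j; lia.
- rewrite -e2 e1 (dR k.+1) /= ?subr0 //.
  by have := ltn_ord j'; lia.
have k0 : k = 0%N by rewrite -e1 e2.
by subst k; rewrite e2 d1 addr0 subr0.
Qed.

(** * Measurability and coin sequences *)

(** Measurability for the discrete sigma-algebra on the target, which any further map preserves;
    countability of the targets is used only to form pairs. *)
Definition discretely_measurable d (T : measurableType d) (C : Type) (f : T -> C) : Prop :=
  forall A : set C, measurable (f @^-1` A).

Lemma discretely_measurable_comp d (T : measurableType d) (C C' : Type)
    (f : T -> C) (g : C -> C') :
  discretely_measurable f -> discretely_measurable (g \o f).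
Proof. by move=> mf A; exact: (mf (g @^-1` A)). Qed.

Lemma discretely_measurable_pair d (T : measurableType d) (C C' : countType)
    (f : T -> C) (g : T -> C') :
  discretely_measurable f -> discretely_measurable g ->
  discretely_measurable (fun w => (f w, g w)).
Proof.
move=> mf mg A.
have -> : (fun w => (f w, g w)) @^-1` A =
    \bigcup_(c : C * C') (f @^-1` [set u | u = c.1 /\ A c] `&` g @^-1` [set c.2]).
  apply/seteqP; split => [w Aw|w [[c c'] _] /= [[-> Ac] ->] //].
  by exists (f w, g w).
apply: countable_bigcupT_measurable; first exact: countableP.
by move=> c; apply: measurableI; [exact: mf|exact: mg].
Qed.

Lemma discretely_measurable_cst d (T : measurableType d) (C : Type) (c : C) :
  discretely_measurable (fun _ : T => c).
Proof. by move=> A; rewrite preimage_cst; case: ifP. Qed.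

(** Induction on time and, within one time, on the line: a new position is a function of the old
    one, the coin and the new positions on the line below. *)
Lemma particle_measurable (R : realType) d (T : measurableType d)
    (P : probability T R) (m : nat) (beta : nat -> nat -> nat -> {RV P >-> nat})
    (X : nat -> nat -> nat -> T -> int) :
  (forall w : T, aztec_dynamics m (fun j i t => beta j i t w) (fun j i t => X j i t w)) ->
  forall t j i, (1 <= i <= j)%N -> (j <= m)%N -> discretely_measurable (X j i t).
Proof.
move=> dyn.
have mb j i t : discretely_measurable (beta j i t).
  by move=> A; apply: measurable_funPTI.
elim=> [|t IHt] j i ij jm.
  have -> : X j i 0%N = (fun=> i%:Z) by apply/funext => w; case: (dyn w) => ->.
  exact: discretely_measurable_cst.
elim: j i ij jm => [|j IHj] i ij jm; first by lia.
have mz : discretely_measurable (fun w => X j.+1 i t w + (beta j.+1 i t.+1 w)%:Z).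
  exact: (discretely_measurable_comp (fun p => p.1 + p.2%:Z)
    (discretely_measurable_pair (IHt _ _ ij jm) (mb j.+1 i t.+1))).
case: (posnP j) => [j0|j_gt0].
  have -> : X j.+1 i t.+1 = (fun w => X j.+1 i t w + (beta j.+1 i t.+1 w)%:Z).
    have -> : i = 1%N by lia.
    by rewrite j0; apply/funext => w; case: (dyn w).
  by [].
have [i1|i_ne1] := eqVneq i 1%N.
  have mr : discretely_measurable (X j i t.+1) by apply: IHj; lia.
  have -> : X j.+1 i t.+1 =
      (fun p : int * int => p.1 - (p.1 == p.2 + 1)%:R) \o
      (fun w => (X j.+1 i t w + (beta j.+1 i t.+1 w)%:Z, X j i t.+1 w)).
    apply/funext => w /=; case: (dyn w) => _ _ dL _ _.
    by rewrite i1 dL //; lia.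
  exact/discretely_measurable_comp/discretely_measurable_pair.
have ml : discretely_measurable (X j i.-1 t.+1) by apply: IHj; lia.
have [ej|i_nej] := eqVneq i j.+1.
  have -> : X j.+1 i t.+1 =
      (fun p : int * int => p.1 + (p.1 == p.2)%:R) \o
      (fun w => (X j.+1 i t w + (beta j.+1 i t.+1 w)%:Z, X j i.-1 t.+1 w)).
    apply/funext => w /=; case: (dyn w) => _ _ _ dR _.
    by rewrite ej dR //; lia.
  exact/discretely_measurable_comp/discretely_measurable_pair.
have mr : discretely_measurable (X j i t.+1) by apply: IHj; lia.
have -> : X j.+1 i t.+1 =
    (fun p : int * (int * int) => p.1 - (p.1 == p.2.1 + 1)%:R + (p.1 == p.2.2)%:R) \o
    (fun w => (X j.+1 i t w + (beta j.+1 i t.+1 w)%:Z, (X j i t.+1 w, X j i.-1 t.+1 w))).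
  apply/funext => w /=; case: (dyn w) => _ _ _ _ dM.
  by rewrite dM //; lia.
apply/discretely_measurable_comp/discretely_measurable_pair => //.
exact: discretely_measurable_pair.
Qed.

Lemma pair_event_measurable (R : realType) d (T : measurableType d)
    (P : probability T R) (m k : nat) (beta : nat -> nat -> nat -> {RV P >-> nat})
    (X : nat -> nat -> nat -> T -> int) t (x : 'rV[int]_k.+1) (y : 'rV[int]_k) :
  (forall w : T, aztec_dynamics m (fun j i t => beta j i t w) (fun j i t => X j i t w)) ->
  (k < m)%N -> measurable (pair_event X t x y).
Proof.
move=> dyn km; have mX := particle_measurable dyn.
have -> : pair_event X t x y =
    (\bigcap_(i in [set: 'I_k.+1]) (X k.+1 i.+1 t @^-1` [set x ord0 i])) `&`
    (\bigcap_(i in [set: 'I_k]) (X k i.+1 t @^-1` [set y ord0 i])).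
  apply/seteqP; split => w /=.
    by rewrite /pair_event /= => -[<- <-]; split => i _ /=; rewrite mxE.
  move=> [Hx Hy]; rewrite /pair_event /=; congr (_, _); apply: row_ext => i; rewrite mxE.
    exact: Hx.
  exact: Hy.
apply: measurableI; apply: fin_bigcap_measurable => // i _; apply: mX => //;
  have := ltn_ord i; lia.
Qed.

(** * Law of the coin sequences *)

Definition coin_positions (K n : nat) : {fset nat * nat * nat} :=
  seq_fset tt [seq p <- [seq (ji, t) | ji <- [seq (j, i) | j <- iota 1 K, i <- iota 1 K],
                                      t <- iota 1 n] | (p.1.2 <= p.1.1)%N].

Lemma mem_coin_positions K n j i t :
  ((j, i, t) \in coin_positions K n) =
  [&& (1 <= i <= j)%N, (j <= K)%N & (1 <= t <= n)%N].
Proof.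
rewrite seq_fsetE mem_filter /=; apply/andP/idP.
  move=> [ij /allpairsP[[ji t'] /= [/allpairsP[[j' i'] /= [hj hi ->]] ht [e1 e2 e3]]]].
  by move: hj hi ht; rewrite -e1 -e2 -e3 !mem_iota; lia.
move=> /and3P[/andP[i1 ij] jK tn]; split=> //.
apply/allpairsP; exists ((j, i), t); split => //=; last by rewrite mem_iota; lia.
by apply/allpairsP; exists (j, i); split => //=; rewrite mem_iota; lia.
Qed.

Definition coin_word (T : Type) (beta : nat -> nat -> nat -> T -> nat) K n (w : T) :
    seq (coin_table K) :=
  mkseq (fun t => coins_of K (fun j i => beta j i t.+1 w)) n.

Definition binary_coins (T : Type) (beta : nat -> nat -> nat -> T -> nat) K n (w : T) : Prop :=
  forall j i t, (1 <= i <= j)%N -> (j <= K)%N -> (1 <= t <= n)%N -> (beta j i t w <= 1)%N.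

(* The constant [c] is the probability of a single word; its value is irrelevant
   since it cancels in conditional probabilities. *)
Lemma prob_coin_words (R : realType) d (T : measurableType d) (P : probability T R)
    (m K n : nat) (beta : nat -> nat -> nat -> {RV P >-> nat}) :
  fair_coins m beta -> (K <= m)%N ->
  exists c : R, forall (A : set T) (a : pred (seq (coin_table K))),
    measurable A ->
    (forall w, binary_coins beta K n w -> A w <-> a (coin_word beta K n w)) ->
    P A = (c * \sum_(l <- words (coin_table K) n) (a l)%:R)%:E.
Proof.
move=> [p0 p1 indep] Km.
pose J := coin_positions K n; pose Y (p : nat * nat * nat) := beta p.1.1 p.1.2 p.2.
have JD : [set` J] `<=` [set p : nat * nat * nat |
    [&& 1 <= p.1.2 <= p.1.1, p.1.1 <= m & 1 <= p.2]%N].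
  by move=> [[j i] t] /=; rewrite mem_coin_positions /=; lia.
pose c0 := coins_of K (fun _ _ => 0%N).
(* Letters are numbered from 0 but times from 1, whence [p.2.-1]. *)
pose v (l : seq (coin_table K)) (p : nat * nat * nat) : nat := bit (nth c0 l p.2.-1) p.1.1 p.1.2.
pose Om l := \bigcap_(p in [set` J]) Y p @^-1` [set v l p].
(* The coins are variables with values in all of [nat]; that the relevant ones are 0 or 1 holds only
   almost surely, on [U]. *)
pose U := \bigcap_(p in [set` J]) Y p @^-1` [set b | (b <= 1)%N].
have mY p A : measurable (Y p @^-1` A) by apply: measurable_funPTI.
have mOm l : measurable (Om l).
  by apply: fin_bigcap_measurable; [exact: finite_fset|move=> p _; exact: mY].
have mU : measurable U.
  by apply: fin_bigcap_measurable; [exact: finite_fset|move=> p _; exact: mY].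
pose e : \bar R := (\prod_(p <- J) (2^-1 : R)%:E)%E.
have POm l : P (Om l) = e.
  rewrite /Om (indep J (fun p => [set v l p])) //.
  rewrite big_seq [RHS]big_seq; apply: eq_bigr => -[[j i] t] pJ.
  have /and3P[ij jm t1] := JD _ pJ; rewrite /v /=.
  by case: (bit _ _ _) => /=; [apply: p1|apply: p0].
have PU : P U = 1%E.
  rewrite /U (indep J (fun=> [set b | (b <= 1)%N])) //.
  rewrite big_seq big1 // => -[[j i] t] pJ.
  have /and3P[ij jm t1] := JD _ pJ.
  have -> : beta j i t @^-1` [set b | (b <= 1)%N] =
      beta j i t @^-1` [set 0%N] `|` beta j i t @^-1` [set 1%N].
    by apply/seteqP; split => w /=; [case: (beta _ _ _ _) => [|[|b]] //; [left|right]|case=> ->].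
  have -> : P (beta j i t @^-1` [set 0%N] `|` beta j i t @^-1` [set 1%N]) =
      (P (beta j i t @^-1` [set 0%N]) + P (beta j i t @^-1` [set 1%N]))%E.
    apply: measureU; [exact: measurable_funPTI|exact: measurable_funPTI|].
    by apply/seteqP; split => w //= [] ->.
  by rewrite p0 // p1 // -EFinD -[X in (X + _)%:E]div1r -[X in (_ + X)%:E]div1r -splitr.
have OmU l w : Om l w -> U w.
  by move=> H p pJ; rewrite /= (H p pJ) /v; case: (bit _ _ _).
have Om_word l w : size l = n -> Om l w -> coin_word beta K n w = l.
  move=> ln H; apply: (@eq_from_nth _ c0); rewrite size_mkseq ?ln // => t tn.
  rewrite nth_mkseq //; apply: coins_of_bit => j i ij jK.
  by apply: (H (j, i, t.+1)); rewrite /= mem_coin_positions; lia.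
have UE w : U w -> binary_coins beta K n w.
  by move=> H j i t ij jK tn; apply: (H (j, i, t)); rewrite /= mem_coin_positions; lia.
have word_Om w : U w -> Om (coin_word beta K n w) w.
  move=> Uw [[j i] t] /=; rewrite mem_coin_positions => /and3P[ij jK tn].
  rewrite /v /= nth_mkseq; last by lia.
  rewrite prednK; last by lia.
  rewrite bit_coins_of //; have := UE _ Uw j i t ij jK tn.
  by rewrite /Y /=; case: (beta j i t w) => [|[|b]].
exists (fine e) => A a mA Aa.
have -> : P A = P (A `&` U).
  have -> : P A = (P (A `\` U) + P (A `&` U))%E := measureDI P mA mU.
  rewrite (_ : P (A `\` U) = 0)%E ?add0e //.
  apply/eqP; rewrite -measure_le0 -[leRHS](_ : P (~` U) = 0)%E; last first.
    by rewrite probability_setC // PU subee.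
  apply: le_measure; rewrite ?inE; [exact: measurableD|exact: measurableC|].
  by move=> w [].
(* On [U] the coins spell exactly one word, so the event is a disjoint union of word events [Om l],
   all of probability [e]. *)
have -> : A `&` U = \bigcup_(l in [set` [seq l <- words (coin_table K) n | a l]]) Om l.
  apply/seteqP; split => [w [Aw Uw]|w [l /=]].
    exists (coin_word beta K n w); last exact: word_Om.
    rewrite /= mem_filter mem_words size_mkseq eqxx andbT.
    by apply/Aa => //; exact: UE.
  rewrite mem_filter mem_words => /andP[al /eqP ln] Hl.
  split; last exact: OmU Hl.
  by apply/Aa; [exact/UE/(OmU l)|rewrite (Om_word l)].
have -> : P (\bigcup_(l in [set` [seq l <- words (coin_table K) n | a l]]) Om l) =
    (\sum_(l \in [set` [seq l <- words (coin_table K) n | a l]]) P (Om l))%E.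
  apply: measure_fin_bigcup; [exact: finite_seq| |by move=> l _].
  apply/trivIsetP => l l' /=; rewrite !mem_filter !mem_words.
  move=> /andP[_ /eqP ln] /andP[_ /eqP l'n] ne.
  apply/seteqP; split => w //= [H H']; move/eqP: ne; apply.
  by rewrite -(Om_word _ _ ln H) (Om_word _ _ l'n H').
rewrite -fsbig_seq ?filter_uniq ?words_uniq //.
have ee : e = (fine e)%:E by rewrite fineK // -(POm [::]) fin_num_measure.
under eq_bigr do rewrite POm ee.
rewrite sumEFin big_filter mulr_sumr big_mkcond; congr (_%:E).
by apply: eq_bigr => l _; case: (a l); rewrite ?mulr1 ?mulr0.
Qed.

(** * The packed start and the conclusion *)

Definition packed_row k : 'rV[int]_k := \row_(i < k) i.+1%:Z.

Lemma interl_packed n : interl (packed_row n.+1) (packed_row n).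
Proof. by apply/interlP => i; rewrite !mxE /= /bump; have := ltn_ord i; lia. Qed.

Lemma interl_packedP n (y : 'rV[int]_n) : interl (packed_row n.+1) y -> y = packed_row n.
Proof.
move=> /interlP H; apply: row_ext => i; have := H i.
by rewrite !mxE /= /bump; have := ltn_ord i; lia.
Qed.

(** A packed row admits only the packed row below it, so the deterministic start is itself a uniform
    pattern. *)
Lemma gt_sum_packed (R : numFieldType) k (F : pattern k -> R) :
  gt_sum (packed_row k) F = F (pattern_of k (fun _ i => i%:Z)).
Proof.
elim: k F => [//|k IH] F /=.
have sp := interl_strict_top (interl_packed k).
rewrite (bigD1_seq (packed_row k)) ?below_uniq ?mem_below ?interl_packed //=.
rewrite big_seq_cond big1 ?addr0; last first.
  by move=> y; rewrite mem_below // => /andP[/interl_packedP ->]; rewrite eqxx.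
by rewrite IH.
Qed.

Lemma pattern_of_run m (b : nat -> nat -> nat -> nat) (X : nat -> nat -> nat -> int) K n r :
  aztec_dynamics m b X -> (K <= m)%N -> (r <= n)%N ->
  (forall j i t, (1 <= i <= j)%N -> (j <= K)%N -> (1 <= t <= n)%N -> (b j i t <= 1)%N) ->
  pattern_of K (fun j i => X j i r) =
  foldl (@step K) (pattern_of K (fun _ i => i%:Z))
    (take r (mkseq (fun t => coins_of K (fun j i => b j i t.+1)) n)).
Proof.
move=> dyn Km rn b01; elim: r rn => [|r IH] rn.
  rewrite take0 /=; apply: eq_pattern_of => j i ij jK.
  by case: dyn => -> //; exact: leq_trans Km.
rewrite (take_nth (coins_of K (fun _ _ => 0%N))) ?size_mkseq // foldl_rcons nth_mkseq //.
rewrite -IH ?(ltnW rn) //; apply: (pattern_of_step dyn Km) => j i ij jK.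
by apply: b01.
Qed.

Lemma pair_eventE (T : Type) (X : nat -> nat -> nat -> T -> int) k t
    (x : 'rV[int]_k.+1) (y : 'rV[int]_k) w :
  pair_event X t x y w <-> at_pair x y (pattern_of k.+1 (fun j i => X j i t w)).
Proof.
rewrite /pair_event /at_pair /= top_pattern_of /line_state; split.
  by move=> [-> ->]; rewrite !eqxx.
by move=> /andP[/eqP -> /eqP ->].
Qed.

Lemma vandermonde_neq0 (R : realType) k (y : 'rV[int]_k) :
  strict y -> vandermonde R y != 0.
Proof.
move=> /strictP sy; apply/prodf_neq0 => i _; apply/prodf_neq0 => j ij.
by rewrite intr_eq0 subr_eq0 gt_eqF // sy.
Qed.

Theorem theorem2p1 (R : realType) (d : measure_display) (T : measurableType d)
    (P : probability T R) (m k : nat)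
    (beta : nat -> nat -> nat -> {RV P >-> nat})
    (X : nat -> nat -> nat -> T -> int)
    (m_ge2 : (2 <= m)%N) (k_range : (1 <= k <= m - 1)%N)
    (coins : fair_coins m beta)
    (dynamics : forall w : T,
      aztec_dynamics m (fun j i t => beta j i t w) (fun j i t => X j i t w))
    (s t : nat) (x : 'rV[int]_k.+1) (y : 'rV[int]_k)
    (x' : 'rV[int]_k.+1) (y' : 'rV[int]_k)
    (xy_W : interlaced x y) (xy'_W : interlaced x' y')
    (pos : (0 < P (pair_event X s x y))%E) :
  cond_prob P (pair_event X (s + t)%N x' y') (pair_event X s x y)
    = q_plus_kernel R t x y x' y'.
Proof.
have km : (k < m)%N by lia.
have xy : interl x y by apply/interlP.
have xy' : interl x' y' by apply/interlP.
have sy := interl_strict xy.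
have mE r (u : 'rV[int]_k.+1) (v : 'rV[int]_k) : measurable (pair_event X r u v).
  exact: (pair_event_measurable _ _ _ dynamics km).
pose K := k.+1; pose C := coin_table K; pose n := (s + t)%N.
have C0 : inhabited (coin_table K) := inhabits (coins_of K (fun _ _ => 0%N)).
pose z0 := pattern_of K (fun _ i => i%:Z).
pose at_s (l : seq C) := at_pair x y (foldl (@step K) z0 (take s l)).
pose at_n (l : seq C) := at_pair x' y' (foldl (@step K) z0 l).
have [c Hc] := prob_coin_words n coins km.
have run w r (u : 'rV[int]_k.+1) (v : 'rV[int]_k) : binary_coins beta K n w -> (r <= n)%N ->
    pair_event X r u v w <-> at_pair u v (foldl (@step K) z0 (take r (coin_word beta K n w))).
  move=> bw rn; rewrite pair_eventE.
  by rewrite (pattern_of_run (n := n) (dynamics w)).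
have at_sP w : binary_coins beta K n w -> pair_event X s x y w <-> at_s (coin_word beta K n w).
  by move=> bw; apply: run; rewrite ?leq_addr.
have at_nP w : binary_coins beta K n w ->
    pair_event X n x' y' w <-> at_n (coin_word beta K n w).
  by move=> bw; rewrite (run w n) // take_oversize // size_mkseq.
pose G (u : pattern K) : R := (at_pair x y u)%:R.
pose F (u : pattern K) : R := (at_pair x' y' u)%:R.
pose visits (H : pattern K -> R) : R :=
  gt_sum (packed_row k) (fun z => iter s (@evolve R K) (fun u => G u * H u) (z, packed_row K)).
have visitsE H : visits H = iter s (@evolve R K) (fun u => G u * H u) z0.
  by rewrite /visits (gt_sum_packed (fun z => iter s _ _ (z, packed_row K))).
(* [c] weighs one word and the power of the cardinal comes from [sum_words]; their product is common
   to both probabilities and cancels. *)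
pose c' := c * #|coin_table K|%:R ^+ n.
have Ps : P (pair_event X s x y) = (c' * visits (fun=> 1))%:E.
  rewrite (Hc _ at_s) //; congr (_%:E); rewrite /c' -mulrA; congr (_ * _).
  rewrite visitsE.
  (* The event at time [s] is also expanded over words of length [s + t], by evolving the constant 1
     for [t] further steps, so that both probabilities carry the same [c']. *)
  have -> : (fun u => G u * 1) = (fun u => G u * iter t (@evolve R K) (fun=> 1) u).
    by apply/funext => u; rewrite evolve1.
  rewrite -(sum_words s t (fun=> 1) G z0 C0); apply: eq_bigr => l _.
  by rewrite mulr1.
have Psn : P (pair_event X n x' y' `&` pair_event X s x y) =
    (c' * visits (iter t (@evolve R K) F))%:E.
  rewrite (Hc _ (fun l => at_s l && at_n l)); [|exact: measurableI|]; last first.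
    move=> w bw; split.
      by move=> [/(at_nP w bw) h1 /(at_sP w bw) h2]; apply/andP.
    by move=> /andP[/(at_sP w bw) h1 /(at_nP w bw) h2]; split.
  congr (_%:E); rewrite /c' -mulrA; congr (_ * _).
  rewrite visitsE -(sum_words s t F G z0 C0); apply: eq_bigr => l _.
  by rewrite -natrM mulnb.
have [v v0 countE] := gt_count_vandermonde R k.
(* Uniformity of the lower rows at time [s] reduces the joint visit to a transition from a uniform
   pattern below [y], which [gt_sum_transition] evaluates. *)
have := gt_sum_visit s x y (iter t (@evolve R K) F) (interl_packed k).
rewrite -/(visits _) -/(visits (fun=> 1)) gt_sum_transition // gt_sum1 // !countE => key.
have hy := vandermonde_neq0 R sy.
have den0 : c' * visits (fun=> 1) != 0.
  by move: pos; rewrite Ps lte_fin lt0r => /andP[].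
move: den0; rewrite mulf_eq0 negb_or => /andP[c'0 vis0].
rewrite /cond_prob Ps Psn /= /q_plus_kernel.
(* The constant [v] between pattern counts and Vandermonde products cancels, leaving the ratio of
   the Doob transform. *)
have -> : visits (iter t (@evolve R K) F) =
    visits (fun=> 1) * (q_kernel R t x y x' y' * vandermonde R y') / vandermonde R y.
  apply: (mulIf (mulf_neq0 v0 hy)); rewrite key; field.
  exact: hy.
by field; rewrite hy vis0.
Qed.
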